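(* Let $N$ and $r$ be positive integers and $i \in \{0, \ldots, N-1\}$. Let $K$ be a compact subset of $$\Lambda = \Big\{x \in \mathbb{R} : \lim_{n \to \infty} \operatorname{discr}\big(X_{nN+i}(x)\big) \text{ exists and is negative}\Big\}.$$ Assume that $$\lim_{n \to \infty} \frac{a_{(n+1)N+i-1}}{a_{nN+i-1}} = 1.$$ If $(X_{nN+i} : n \in \mathbb{N})$ belongs to $\mathcal{D}_r\big(K, \operatorname{GL}(2, \mathbb{R})\big)$, then there is a constant $c>1$ such that for every $x \in K$, every generalized eigenvector $(u_n : n \in \mathbb{N}_0)$ associated with $x$, and all $n \geq 1$, $$c^{-1} \big( u_0^2 + u_1^2 \big) \leq a_{nN+i-1} \big( u_{nN+i-1}^2 + u_{nN+i}^2 \big) \leq c \big( u_0^2 + u_1^2 \big).$$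
   Context: $\mathbb{N}$ is the set of positive integers, $\mathbb{N}_0=\mathbb{N}\cup\{0\}$. $(a_n : n \in \mathbb{N}_0)$ is a sequence of positive numbers and $(b_n : n \in \mathbb{N}_0)$ a sequence of real numbers. For $n\ge 1$ and $x \in \mathbb{R}$, $$B_n(x) = \begin{pmatrix} 0 & 1 \\ -\frac{a_{n-1}}{a_n} & \frac{x-b_n}{a_n} \end{pmatrix}, \qquad X_n(x) = \prod_{j=n}^{n+N-1} B_j(x) = B_{n+N-1}(x) B_{n+N-2}(x)\cdots B_n(x).$$ A generalized eigenvector associated with $x\in\mathbb{R}$ is a non-zero real sequence $(u_n : n\in\mathbb{N}_0)$ with $a_{n-1}u_{n-1}+b_nu_n+a_nu_{n+1}=xu_n$ for all $n\ge1$. For a $2\times2$ matrix $X$, $\operatorname{discr} X = (\operatorname{tr} X)^2 - 4\det X$. For a compact set $K\subset\mathbb{R}$ and $r\in\mathbb{N}$, a uniformly bounded sequence of continuous mappings $A_n : K\to \operatorname{GL}(2,\mathbb{R})$, $n \geq 1$, belongs to $\mathcal{D}_r(K,\operatorname{GL}(2,\mathbb{R}))$ if for each $j\in\{1,\ldots,r\}$, $$\sum_{n\ge1}\sup_{x\in K}\big\|\Delta^jA_n(x)\big\|^{r/j}<\infty,$$ where $\Delta^0A_n=A_n$ and $\Delta^jA_n=\Delta^{j-1}A_{n+1}-\Delta^{j-1}A_n$. *)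

(* Defs.v *)
From mathcomp Require Import all_boot all_order all_algebra.
From mathcomp Require Import all_classical all_reals all_analysis.

Set Implicit Arguments.
Unset Strict Implicit.
Unset Printing Implicit Defensive.

Import Order.TTheory GRing.Theory Num.Theory.
Import numFieldNormedType.Exports.

Local Open Scope classical_set_scope.
Local Open Scope ring_scope.

Section Jacobi.
Context {R : realType}.
Implicit Types (a b u : nat -> R) (x : R).

(* Only meant for [0 < n]. *)
Definition transfer_mx a b (n : nat) x : 'M[R]_2 :=
  \matrix_(k < 2, l < 2)
    nth 0 (nth [::] [:: [:: 0                  ; 1              ];
                        [:: - (a n.-1 / a n) ; (x - b n) / a n]] k) l.

(* The factors are multiplied with the highest index on the left. *)
Definition N_step_transfer_mx a b (N n : nat) x : 'M[R]_2 :=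
  \prod_(j <- rev (index_iota n (n + N))) transfer_mx a b j x.

Definition gen_eigenvector a b x u : Prop :=
  (exists n, u n != 0) /\
  (forall n, (1 <= n)%N ->
     a n.-1 * u n.-1 + b n * u n + a n * u n.+1 = x * u n).

End Jacobi.

Definition discr {R : realType} (X : 'M[R]_2) : R :=
  (\tr X) ^+ 2 - 4 * \det X.

Definition Lambda {R : realType} (a b : nat -> R) (N i : nat) : set R :=
  [set x | exists l : R, l < 0 /\
     discr (N_step_transfer_mx a b N (n * N + i)%N x) @[n --> \oo] --> l].

Fixpoint Delta {V : zmodType} (j : nat) (A : nat -> V) (n : nat) : V :=
  if j is j'.+1 then Delta j' A n.+1 - Delta j' A n else A n.

(* The sequence is indexed by [n >= 1]; the value of [A] at [0] is irrelevant.
   The matrix norm is the entrywise maximum: all norms on 2 x 2 matrices being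
   equivalent, the class does not depend on this choice.  The real-valued [sup]
   is that of a bounded set by uniform boundedness, and is 0 if [K] is empty. *)
Record in_D {R : realType} (r : nat) (K : set R) (A : nat -> R -> 'M[R]_2)
    : Prop := InD {
  in_D_unit : forall n x, (1 <= n)%N -> K x -> A n x \in unitmx ;
  in_D_continuous : forall n, (1 <= n)%N -> {within K, continuous (A n)} ;
  in_D_bounded : exists M : R,
    forall n x, (1 <= n)%N -> K x -> `|A n x| <= M ;
  in_D_summable : forall j, (1 <= j <= r)%N ->
    (\sum_(1 <= n <oo)
       (sup [set `|Delta j (A ^~ x) n| `^ (r%:R / j%:R) | x in K])%:E
     < +oo)%E
}.

(* Main.v *)
Require Import Defs.
From mathcomp Require Import all_boot all_order all_algebra.
From mathcomp Require Import all_classical all_reals all_analysis.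
From mathcomp Require Import ring lra zify.

Set Implicit Arguments.
Unset Strict Implicit.
Unset Printing Implicit Defensive.

Import Order.TTheory GRing.Theory Num.Theory.
Import numFieldNormedType.Exports.

Local Open Scope classical_set_scope.
Local Open Scope ring_scope.

(** Write [X_n] for the [N]-step transfer matrix at [n * N + i], with entries
    [a, b, c, d], [v_n] for the vector [(u (n * N + i - 1), u (n * N + i))] and
    [al_n] for [a (n * N + i - 1)].  Then [v_(n+1) = X_n v_n], and telescoping
    determinants give [al_(n+1) * det X_n = al_n].

    A real matrix [X] acts on non-real numbers by
    [X . z = (c + d z) / (a + b z)], and the definite form
    [F_z (v) = |v2 - z v1|^2 / Im z] satisfies [F_(X.z) (X v) = det X * F_z v]
    (lemma [mobius_form_invariant]).  So if [z_(n+1) = X_n . z_n] held exactly,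
    [al_n F_(z_n) (v_n)] would be constant; as [F_z] is comparable with the
    Euclidean norm while [z] stays bounded and away from the real axis, this
    would be the theorem.  It suffices that [z_n] solves this recurrence up to a
    defect that is summable uniformly in [x]: then consecutive energies differ
    by a summable relative error (lemmas [mobius_form_step] and
    [quasi_constant]).

    Such [z_n] exist because the discriminant is negative.  The fixed point
    [(d - a + i s) / (2 b)] of [X_n], with [s] the square root of [- discr X_n],
    solves the recurrence up to a defect [G] controlled by the first differences
    of [X_n].  At the fixed point the linearized recurrence is multiplication by
    [- i s], which is invertible, and the correction [G / (i s)] replaces [G] by
    terms with one more difference.  After [r - 1] corrections the defect has
    order [r] (lemma [riccati_iter]), and [r] differences in total is exactly
    what the class [in_D] makes summable.

    Orders are counted against one sequence [w] with [w ^ r] summable that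
    bounds every [j]-th difference of the entries by a multiple of [w ^ j]
    (lemma [in_D_majorant]).  Products of differences then need no Hoelder
    inequality: exponents just add up.

    Everything must be uniform in [x].  The only hypothesis that is pointwise is
    the convergence of the discriminants; they are polynomials in [x] of degree
    at most [2 N], hence determined by finitely many points of [K], so that they
    are eventually bounded by one negative constant on [K] (lemma
    [poly_uniformly_negative]).  The finitely many remaining indices are handled
    one transfer matrix at a time. *)

(** * Sequences graded by their number of differences *)

Section OrderCalculus.
Context {R : realType} {T : Type}.
Variables (K : set T) (w : nat -> R) (B : R).
Hypotheses (w_ge0 : forall n, 0 <= w n) (w_le : forall n, w n <= B)
  (w_shift : forall n, w n.+1 <= B * w n).
Implicit Types (f g : T -> nat -> R) (m k l : nat).

Definition fdiff f : T -> nat -> R := fun x n => f x n.+1 - f x n.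
Definition fshift f : T -> nat -> R := fun x n => f x n.+1.

Definition dominated k f :=
  exists C, forall x n, K x -> `|f x n| <= C * w n ^+ k.

(** [f] has order [k], up to [m] further differences: the [j]-th difference of
    [f] is a multiple of [w ^ (k + j)] for [j <= m], uniformly on [K].  It
    is defined by recursion on [m] because the closure properties below are all
    proved by that induction. *)
Fixpoint Ord m k f : Prop :=
  dominated k f /\ (if m is m'.+1 then Ord m' k.+1 (fdiff f) else True).

Lemma bound_ge0 : 0 <= B.
Proof. exact: le_trans (w_ge0 0) (w_le 0). Qed.

Lemma dominated_ge0 k f : dominated k f ->
  exists C, 0 <= C /\ forall x n, K x -> `|f x n| <= C * w n ^+ k.
Proof.
move=> [C fC]; exists `|C|; split=> // x n Kx.
by rewrite (le_trans (fC _ n Kx)) // ler_wpM2r ?exprn_ge0 ?ler_norm.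
Qed.

Lemma dominated_weaken k l f : (k <= l)%N -> dominated l f -> dominated k f.
Proof.
move=> kl /dominated_ge0[C [C0 fC]]; exists (C * B ^+ (l - k)) => x n Kx.
rewrite (le_trans (fC _ n Kx)) // -mulrA ler_wpM2l //.
rewrite -{1}(subnK kl) exprD ler_wpM2r ?exprn_ge0 //.
by rewrite lerXn2r ?nnegrE ?bound_ge0.
Qed.

Lemma dominatedD k f g : dominated k f -> dominated k g ->
  dominated k (fun x n => f x n + g x n).
Proof.
move=> [C fC] [D gD]; exists (C + D) => x n Kx.
by rewrite mulrDl (le_trans (ler_normD _ _)) // lerD ?fC ?gD.
Qed.

Lemma dominatedM k l f g : dominated k f -> dominated l g ->
  dominated (k + l) (fun x n => f x n * g x n).
Proof.
move=> [C fC] [D gD]; exists (C * D) => x n Kx.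
by rewrite normrM exprD mulrACA ler_pM ?fC ?gD.
Qed.

Lemma dominated_shift k f : dominated k f -> dominated k (fshift f).
Proof.
move=> /dominated_ge0[C [C0 fC]]; exists (C * B ^+ k) => x n Kx.
rewrite (le_trans (fC _ _ Kx)) // -mulrA ler_wpM2l // -exprMn.
by rewrite lerXn2r ?nnegrE ?mulr_ge0 ?bound_ge0.
Qed.

Lemma dominated0P f : (exists C, forall x n, K x -> `|f x n| <= C) ->
  dominated 0 f.
Proof. by move=> [C fC]; exists C => x n Kx; rewrite expr0 mulr1 fC. Qed.

Lemma Ord_dominated m k f : Ord m k f -> dominated k f.
Proof. by case: m => [|m] []. Qed.

Lemma Ord_ext m k f g : (forall x n, K x -> f x n = g x n) ->
  Ord m k f -> Ord m k g.
Proof.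
elim: m k f g => [|m IH] k f g fg /= [[C fC] Hf]; split.
- by exists C => x n Kx; rewrite -fg ?fC.
- by [].
- by exists C => x n Kx; rewrite -fg ?fC.
by apply: IH Hf => x n Kx; rewrite /fdiff !fg.
Qed.

Lemma OrdW m' m k l f : (m <= m')%N -> (k <= l)%N -> Ord m' l f -> Ord m k f.
Proof.
elim: m m' k l f => [|m IH] m' k l f mm' kl Hf; split=> //;
  try exact: dominated_weaken kl (Ord_dominated Hf).
case: m' mm' Hf => [|m'] // mm' [_ Hf].
by apply: IH Hf.
Qed.

Lemma Ord0 m k : Ord m k (fun _ _ => 0).
Proof.
elim: m k => [|m IH] k; split=> //;
  try by exists 0 => x n _; rewrite normr0 mul0r.
by apply: Ord_ext (IH k.+1) => x n _; rewrite /fdiff subrr.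
Qed.

Lemma Ord_cst m (c : R) : Ord m 0 (fun _ _ => c).
Proof.
have dc : dominated 0 (fun _ _ => c) by apply: dominated0P; exists `|c|.
case: m => [|m]; split=> //.
by apply: Ord_ext (Ord0 m 1) => x n _; rewrite /fdiff subrr.
Qed.

Lemma OrdD m k f g : Ord m k f -> Ord m k g ->
  Ord m k (fun x n => f x n + g x n).
Proof.
elim: m k f g => [|m IH] k f g /= [fk Hf] [gk Hg]; split=> //;
  try exact: dominatedD.
by apply: Ord_ext (IH _ _ _ Hf Hg) => x n _; rewrite /fdiff; ring.
Qed.

Lemma Ord_shift m k f : Ord m k f -> Ord m k (fshift f).
Proof.
elim: m k f => [|m IH] k f /= [fk Hf]; split=> //; try exact: dominated_shift.
exact: (IH _ (fdiff f)).
Qed.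

(** Leibniz rule: [fdiff (f g) = fdiff f * shift g + f * fdiff g], where
    shifting keeps the order because [w] varies slowly. *)
Lemma OrdM m k l f g : Ord m k f -> Ord m l g ->
  Ord m (k + l) (fun x n => f x n * g x n).
Proof.
elim: m k l f g => [|m IH] k l f g Hf Hg; split=> //;
  try by apply: dominatedM; apply: Ord_dominated; eassumption.
have [_ df] := Hf; have [_ dg] := Hg.
have sg : Ord m l (fshift g) by apply: OrdW (Ord_shift Hg).
have f' : Ord m k f by apply: OrdW Hf.
have H1 := IH _ _ _ _ df sg; have H2 := IH _ _ _ _ f' dg.
rewrite addnS in H2; apply: Ord_ext (OrdD H1 H2) => x n _.
by rewrite /fdiff /fshift; ring.
Qed.

Lemma Ord_diff m k f : Ord m.+1 k f -> Ord m k.+1 (fdiff f).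
Proof. by case. Qed.

Lemma OrdZ m k c f : Ord m k f -> Ord m k (fun x n => c * f x n).
Proof. by move=> Hf; exact: (OrdM (Ord_cst m c) Hf). Qed.

Lemma OrdN m k f : Ord m k f -> Ord m k (fun x n => - f x n).
Proof.
by move=> Hf; apply: Ord_ext (OrdZ (-1) Hf) => x n _; rewrite mulN1r.
Qed.

Lemma OrdB m k f g : Ord m k f -> Ord m k g ->
  Ord m k (fun x n => f x n - g x n).
Proof. by move=> Hf Hg; exact: OrdD Hf (OrdN Hg). Qed.

(** By induction on [m], since
    [fdiff (1 / f) = - fdiff f / (f * shift f)]: differences of [1 / f] up to [m]
    control the next one. *)
Lemma Ord_inv m f (e : R) : 0 < e -> (forall x n, K x -> e <= `|f x n|) ->
  Ord m 0 f -> Ord m 0 (fun x n => (f x n)^-1).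
Proof.
move=> e0 ef.
have fV0 x n : K x -> f x n != 0.
  by move=> Kx; rewrite -normr_gt0 (lt_le_trans e0) ?ef.
have dV : dominated 0 (fun x n => (f x n)^-1).
  apply: dominated0P; exists e^-1 => x n Kx.
  by rewrite normfV lef_pV2 ?posrE ?ef ?normr_gt0 ?fV0.
elim: m => [|m IH] Hf; split=> //.
have Hf' : Ord m 0 f by apply: OrdW Hf.
have HV := IH Hf'.
have := OrdN (OrdM (Ord_diff Hf) (OrdM HV (Ord_shift HV))).
apply: Ord_ext => x n Kx; rewrite /fdiff /fshift.
by field; rewrite !fV0.
Qed.

(** Same induction, from
    [fdiff (sqrt f) = fdiff f / (sqrt f + shift (sqrt f))]. *)
Lemma Ord_sqrt m f (e : R) : 0 < e -> (forall x n, K x -> e <= f x n) ->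
  Ord m 0 f -> Ord m 0 (fun x n => Num.sqrt (f x n)).
Proof.
move=> e0 ef.
have f0 x n : K x -> 0 < f x n by move=> Kx; rewrite (lt_le_trans e0) ?ef.
have se0 : 0 < Num.sqrt e by rewrite sqrtr_gt0.
have sf x n : K x -> Num.sqrt e <= Num.sqrt (f x n).
  by move=> Kx; rewrite ler_wsqrtr ?ef.
have ds m' : Ord m' 0 f -> dominated 0 (fun x n => Num.sqrt (f x n)).
  move=> /Ord_dominated/dominated_ge0[C [C0 fC]]; apply: dominated0P.
  exists (C + 1) => x n Kx; rewrite ger0_norm ?sqrtr_ge0 //.
  have := fC x n Kx; rewrite expr0 mulr1 ger0_norm; last exact: ltW (f0 x n Kx).
  move=> fxC.
  have := sqr_sqrtr (ltW (f0 x n Kx)); have := sqrtr_ge0 (f x n).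
  move: (Num.sqrt (f x n)) (f x n) fxC => s t tC s0 st; nra.
elim: m => [|m IH] Hf; split=> //; try exact: ds Hf.
have Hf' : Ord m 0 f by apply: OrdW Hf.
have HS := IH Hf'; have HD := OrdD HS (Ord_shift HS).
have HV : Ord m 0 (fun x n => (Num.sqrt (f x n) + fshift (fun x n => Num.sqrt (f x n)) x n)^-1).
  apply: Ord_inv se0 _ HD => x n Kx; rewrite /fshift ger0_norm.
    by have H1 := sf x n Kx; have H2 := sqrtr_ge0 (f x n.+1); lra.
  by rewrite addr_ge0 ?sqrtr_ge0.
have := OrdM (Ord_diff Hf) HV.
apply: Ord_ext => x n Kx; rewrite /fdiff /fshift.
have := sf x n Kx; have := sf x n.+1 Kx.
rewrite -{2}(sqr_sqrtr (ltW (f0 x n Kx))) -{2}(sqr_sqrtr (ltW (f0 x n.+1 Kx))).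
move: (Num.sqrt (f x n)) (Num.sqrt (f x n.+1)) => s t st tt.
by field; rewrite lt0r_neq0 //; lra.
Qed.

(** * Approximate solutions of the matrix Riccati recurrence *)

Definition discr_seq (a b c d : T -> nat -> R) x n :=
  (a x n + d x n) ^+ 2 - 4 * (a x n * d x n - b x n * c x n).

(** Real and imaginary part of [c + d z_n - z_(n+1) (a + b z_n)] for
    [z = p + i q]: the defect of [z] in the recurrence
    [z_(n+1) = (c + d z_n) / (a + b z_n)]. *)
Definition ric_re (a b c d p q : T -> nat -> R) x n :=
  c x n + d x n * p x n - p x n.+1 * (a x n + b x n * p x n)
  + q x n.+1 * (b x n * q x n).
Definition ric_im (a b c d p q : T -> nat -> R) x n :=
  d x n * q x n - q x n.+1 * (a x n + b x n * p x n)
  - p x n.+1 * (b x n * q x n).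

Section Riccati.
Variables (a b c d : T -> nat -> R) (r : nat) (e : R).
Hypotheses (Ha : Ord r 0 a) (Hb : Ord r 0 b) (Hc : Ord r 0 c) (Hd : Ord r 0 d).
Hypotheses (e_gt0 : 0 < e)
  (disc_le : forall x n, K x -> discr_seq a b c d x n <= - e).

Let s x n := Num.sqrt (- discr_seq a b c d x n).
(* [p0 + i q0] is the fixed point of the matrix.  Its imaginary part has the
   sign of [b]; only its absolute value matters below. *)
Let p0 x n := (d x n - a x n) * (2 * b x n)^-1.
Let q0 x n := s x n * (2 * b x n)^-1.

(** A matrix with negative discriminant has no real eigenvector, so its
    off-diagonal entries do not vanish; quantitatively,
    [4 b c <= discr <= - e]. *)
Lemma offdiag_bounded_away : exists2 e', 0 < e' & forall x n, K x -> e' <= `|b x n|.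
Proof.
have e0 := e_gt0; have [C [C0 cC]] := dominated_ge0 (Ord_dominated Hc).
have C1 : 0 < 4 * (C + 1) by lra.
exists (e / (4 * (C + 1))); first by rewrite divr_gt0.
move=> x n Kx; rewrite ler_pdivrMr //.
have := cC x n Kx; rewrite expr0 mulr1 => H1.
have H2 : e <= 4 * `|b x n * c x n|.
  have := disc_le n Kx; rewrite /discr_seq => H2.
  have H3 := ler_norm (- (b x n * c x n)); rewrite normrN in H3.
  move: (b x n) (c x n) (a x n) (d x n) H2 H3 => b' c' a' d' H2 H3.
  by have := sqr_ge0 (a' - d'); nra.
rewrite normrM in H2; have := normr_ge0 (b x n); nra.
Qed.

Lemma sqrt_discr_gt0 x n : K x -> 0 < s x n.
Proof. by move=> Kx; rewrite sqrtr_gt0; have := disc_le n Kx; have := e_gt0; lra. Qed.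

Lemma sqrt_discr_ge x n : K x -> Num.sqrt e <= s x n.
Proof. by move=> Kx; rewrite ler_wsqrtr // lerNr disc_le. Qed.

Lemma sqrt_discr_sqr x n : K x ->
  s x n ^+ 2 = - ((d x n - a x n) ^+ 2 + 4 * (b x n * c x n)).
Proof.
move=> Kx; rewrite /s sqr_sqrtr; last by have := disc_le n Kx; have := e_gt0; lra.
by rewrite /discr_seq; ring.
Qed.

Lemma Ord_disc : Ord r 0 (fun x n => - discr_seq a b c d x n).
Proof.
have := OrdN (OrdB (OrdM (OrdD Ha Hd) (OrdD Ha Hd))
  (OrdZ 4 (OrdB (OrdM Ha Hd) (OrdM Hb Hc)))).
by apply: Ord_ext => x n _; rewrite /discr_seq expr2.
Qed.

Lemma Ord_sqrt_discr : Ord r 0 s.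
Proof.
by apply: (Ord_sqrt e_gt0 _ Ord_disc) => x n Kx; rewrite lerNr disc_le.
Qed.

Lemma Ord_sqrt_discrV : Ord r 0 (fun x n => (s x n)^-1).
Proof.
apply: (@Ord_inv _ _ (Num.sqrt e)) Ord_sqrt_discr; first by rewrite sqrtr_gt0.
by move=> x n Kx; rewrite ger0_norm ?sqrt_discr_ge ?sqrtr_ge0.
Qed.

Lemma Ord_2bV : Ord r 0 (fun x n => (2 * b x n)^-1).
Proof.
have [e' e'0 He'] := offdiag_bounded_away.
apply: (Ord_inv e'0) (OrdZ 2 Hb) => x n Kx.
by rewrite normrM ger0_norm //; have := He' x n Kx; lra.
Qed.

Lemma Ord_p0 : Ord r 0 p0. Proof. exact: OrdM (OrdB Hd Ha) Ord_2bV. Qed.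
Lemma Ord_q0 : Ord r 0 q0. Proof. exact: OrdM Ord_sqrt_discr Ord_2bV. Qed.

Lemma b_neq0 x n : K x -> b x n != 0.
Proof.
move=> Kx; have [e' e'0 He'] := offdiag_bounded_away.
by rewrite -normr_gt0 (lt_le_trans e'0) ?He'.
Qed.

Lemma root_coeffs x n : K x ->
  d x n = a x n + 2 * b x n * p0 x n /\ s x n = 2 * b x n * q0 x n.
Proof. by move=> Kx; rewrite /p0 /q0; split; field; exact: b_neq0. Qed.

(** Write [z0 = p0 + i q0].  Replacing [z] by [z + h] changes the defect [G] by
    [- i s h + h b (2 z0 - z - z^+) - (h^+ - h) (a + b z) - b h h^+], where
    [z^+] and [h^+] are the shifts and where [d - a = 2 b z0 - i s] was used.
    The choice [h = G / (i s)] cancels [G].  If [G], hence [h], has order [k],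
    the other terms have order at least [k + 1]: [2 z0 - z - z^+] has order 1
    because [z - z0] and the differences of [z0] do.  Each step uses up one
    difference of the entries, whence the condition on [m]. *)
Lemma riccati_iter k m : (m + k.+1 = r)%N -> exists p q,
  [/\ Ord m 1 (fun x n => p x n - p0 x n), Ord m 1 (fun x n => q x n - q0 x n),
      Ord m k.+1 (ric_re a b c d p q) & Ord m k.+1 (ric_im a b c d p q)].
Proof.
elim: k m => [|k IH] m mr.
  have [a0 b0] : Ord m 0 a /\ Ord m 0 b by split; [move: Ha|move: Hb]; apply: OrdW; lia.
  have [P0 Q0] : Ord m 0 p0 /\ Ord m 0 q0.
    by split; [move: Ord_p0|move: Ord_q0]; apply: OrdW; lia.
  have [dP dQ] : Ord m 1 (fdiff p0) /\ Ord m 1 (fdiff q0).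
    have mr' : m.+1 = r by lia.
    by split; apply: Ord_diff; rewrite mr'; [exact: Ord_p0|exact: Ord_q0].
  exists p0, q0; split.
  - by apply: Ord_ext (Ord0 m 1) => x n _; rewrite subrr.
  - by apply: Ord_ext (Ord0 m 1) => x n _; rewrite subrr.
  - have := OrdD (OrdN (OrdM dP (OrdD a0 (OrdM b0 P0)))) (OrdM dQ (OrdM b0 Q0)).
    apply: Ord_ext => x n Kx; rewrite /ric_re /fdiff.
    have := sqrt_discr_sqr n Kx; have b' := b_neq0 n Kx.
    rewrite /p0 /q0; move: (s x n) (s x n.+1) (a x n.+1) (b x n.+1) (d x n.+1).
    move: (a x n) (b x n) (c x n) (d x n) b' => a' b_ c' d' b' s0 s1 a1 b1 d1 sE.
    have -> : c' = (- s0 ^+ 2 - (d' - a') ^+ 2) / (4 * b_) by rewrite sE; field.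
    by move: ((2 * b1)^-1) => i1; field.
  - have := OrdD (OrdN (OrdM dQ (OrdD a0 (OrdM b0 P0)))) (OrdN (OrdM dP (OrdM b0 Q0))).
    apply: Ord_ext => x n Kx; rewrite /ric_im /fdiff.
    have b' := b_neq0 n Kx.
    rewrite /p0 /q0; move: (s x n) (s x n.+1) (a x n.+1) (b x n.+1) (d x n.+1).
    move: (a x n) (b x n) (d x n) b' => a' b_ d' b' s0 s1 a1 b1 d1.
    by move: ((2 * b1)^-1) => i1; field.
have [|p [q [Dp Dq Gr Gi]]] := IH m.+1; first by lia.
(* [h + i g = G / (i s)] *)
pose h x n := ric_im a b c d p q x n * (s x n)^-1.
pose g x n := - (ric_re a b c d p q x n * (s x n)^-1).
have sV : Ord m.+1 0 (fun x n => (s x n)^-1) by move: Ord_sqrt_discrV; apply: OrdW; lia.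
have Hh : Ord m.+1 k.+1 h by rewrite -(addn0 k.+1); exact: OrdM Gi sV.
have Hg : Ord m.+1 k.+1 g by rewrite -(addn0 k.+1); exact/OrdN/OrdM.
have dh := Ord_diff Hh; have dg := Ord_diff Hg.
have wk j f : Ord m.+1 j f -> Ord m j f by apply: OrdW.
have w1 f : Ord m.+1 k.+1 f -> Ord m 1 f by apply: OrdW.
have [a0 b0] : Ord m 0 a /\ Ord m 0 b by split; [move: Ha|move: Hb]; apply: OrdW; lia.
have [P0 Q0] : Ord m.+2 0 p0 /\ Ord m.+2 0 q0.
  by split; [move: Ord_p0|move: Ord_q0]; apply: OrdW; lia.
have P : Ord m 0 p.
  apply: (@Ord_ext _ _ (fun x n => (p x n - p0 x n) + p0 x n)).
    by move=> x n _; ring.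
  by apply: OrdD; [apply: OrdW Dp|apply: OrdW P0]; lia.
have Q : Ord m 0 q.
  apply: (@Ord_ext _ _ (fun x n => (q x n - q0 x n) + q0 x n)).
    by move=> x n _; ring.
  by apply: OrdD; [apply: OrdW Dq|apply: OrdW Q0]; lia.
have dev f f0 : Ord m.+2 0 f0 -> Ord m.+1 1 (fun x n => f x n - f0 x n) ->
    Ord m 1 (fun x n => b x n * (2 * f0 x n - f x n - f x n.+1)).
  move=> F0 Df; have Df' : Ord m 1 (fdiff (fun x n => f x n - f0 x n)).
    by apply: OrdW (Ord_diff Df).
  have dF0 : Ord m 1 (fdiff f0) by apply: OrdW (Ord_diff F0).
  have := OrdM b0 (OrdN (OrdD (OrdZ 2 (wk _ _ Df)) (OrdD dF0 Df'))).
  by apply: Ord_ext => x n _; rewrite /fdiff; ring.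
have U := dev _ _ P0 Dp; have V := dev _ _ Q0 Dq.
have hm := wk _ _ Hh; have gm := wk _ _ Hg.
have W : Ord m 0 (fun x n => a x n + b x n * p x n) by exact: OrdD a0 (OrdM b0 P).
have Z : Ord m 0 (fun x n => b x n * q x n) by exact: (OrdM b0 Q).
have b1 : Ord m.+1 0 b by move: Hb; apply: OrdW; lia.
have hs : Ord m 1 (fun x n => b x n * h x n.+1).
  exact: w1 (OrdM b1 (Ord_shift Hh)).
have gs : Ord m 1 (fun x n => b x n * g x n.+1).
  exact: w1 (OrdM b1 (Ord_shift Hg)).
have co f : Ord m (k.+1 + 1) f -> Ord m k.+2 f by rewrite addn1.
have co0 f : Ord m (k.+2 + 0) f -> Ord m k.+2 f by rewrite addn0.
exists (fun x n => p x n + h x n), (fun x n => q x n + g x n); split.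
- apply: Ord_ext (OrdD (wk _ _ Dp) (w1 _ Hh)) => x n _; ring.
- apply: Ord_ext (OrdD (wk _ _ Dq) (w1 _ Hg)) => x n _; ring.
- have T1 := co _ (OrdB (OrdM hm (OrdB U hs)) (OrdM gm (OrdB V gs))).
  have T2 := co0 _ (OrdB (OrdM dh W) (OrdM dg Z)).
  apply: Ord_ext (OrdB T1 T2) => x n Kx.
  have gE : ric_re a b c d p q x n = - (s x n * g x n).
    by rewrite /g; field; exact: lt0r_neq0 (sqrt_discr_gt0 n Kx).
  have [dE sE] := root_coeffs n Kx.
  rewrite /ric_re /fdiff dE sE in gE *.
  transitivity (- (2 * b x n * q0 x n * g x n) + (
    (a x n + 2 * b x n * p0 x n) * h x n - p x n.+1 * (b x n * h x n)
    - h x n.+1 * (a x n + b x n * (p x n + h x n))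
    + q x n.+1 * (b x n * g x n) + g x n.+1 * (b x n * (q x n + g x n)))).
    by ring.
  by rewrite -gE; ring.
- have T1 := co _ (OrdD (OrdM hm (OrdB V gs)) (OrdM gm (OrdB U hs))).
  have T2 := co0 _ (OrdD (OrdM dg W) (OrdM dh Z)).
  apply: Ord_ext (OrdB T1 T2) => x n Kx.
  have hE : ric_im a b c d p q x n = s x n * h x n.
    by rewrite /h; field; exact: lt0r_neq0 (sqrt_discr_gt0 n Kx).
  have [dE sE] := root_coeffs n Kx.
  rewrite /ric_im /fdiff dE sE in hE *.
  transitivity (2 * b x n * q0 x n * h x n + (
    (a x n + 2 * b x n * p0 x n) * g x n - q x n.+1 * (b x n * h x n)
    - g x n.+1 * (a x n + b x n * (p x n + h x n))
    - p x n.+1 * (b x n * g x n) - h x n.+1 * (b x n * (q x n + g x n)))).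
    by ring.
  by rewrite -hE; ring.
Qed.

Lemma q0_bounded_away : exists2 e', 0 < e' & forall x n, K x -> e' <= `|q0 x n|.
Proof.
have [C [C0 bC]] := dominated_ge0 (Ord_dominated Hb).
have se : 0 < Num.sqrt e by rewrite sqrtr_gt0.
have C1 : 0 < 2 * (C + 1) by lra.
exists (Num.sqrt e / (2 * (C + 1))); first by rewrite divr_gt0.
move=> x n Kx; rewrite normrM normfV ger0_norm ?sqrtr_ge0 //.
have bC' := bC x n Kx; rewrite expr0 mulr1 in bC'.
apply: ler_pM; rewrite ?invr_ge0 ?sqrtr_ge0 ?sqrt_discr_ge //; first exact: ltW.
rewrite lef_pV2 ?posrE ?normr_gt0 ?mulf_neq0 ?b_neq0 ?pnatr_eq0 //.
by rewrite normrM ger0_norm //; lra.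
Qed.

Lemma approx_riccati : (0 < r)%N -> exists p q M e',
  [/\ 0 < e', 0 <= M & forall x n, K x ->
    [/\ `|p x n| <= M, `|q x n| <= M, e' - M * w n <= `|q x n|,
        `|ric_re a b c d p q x n| <= M * w n ^+ r
      & `|ric_im a b c d p q x n| <= M * w n ^+ r]].
Proof.
case: r Ord_p0 Ord_q0 riccati_iter => // k P0 Q0 /(_ k 0%N)[]// p [q [Dp Dq Gr Gi]] _.
have bd f f0 : Ord k.+1 0 f0 -> Ord 0 1 (fun x n => f x n - f0 x n) ->
    exists C, 0 <= C /\ forall x n, K x -> `|f x n| <= C * w n ^+ 0.
  move=> F0 Df; apply: dominated_ge0; apply: (@Ord_dominated 0).
  apply: (@Ord_ext _ _ (fun x n => (f x n - f0 x n) + f0 x n)).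
    by move=> x n _; ring.
  by apply: OrdD; [apply: OrdW Df|apply: OrdW F0].
have [Mp [Mp0 pM]] := bd _ _ P0 Dp; have [Mq [Mq0 qM]] := bd _ _ Q0 Dq.
have [Md [Md0 dM]] := dominated_ge0 (Ord_dominated Dq).
have [Mr [Mr0 rM]] := dominated_ge0 (Ord_dominated Gr).
have [Mi [Mi0 iM]] := dominated_ge0 (Ord_dominated Gi).
have [e' e'0 He'] := q0_bounded_away.
pose M := Mp + Mq + Md + Mr + Mi.
have le_M C y t : 0 <= t -> C <= M -> y <= C * t -> y <= M * t.
  by move=> t0 CM /le_trans; apply; rewrite ler_wpM2r.
exists p, q, M, e'; split=> //; first by rewrite /M; lra.
move=> x n Kx; rewrite -[M in `|p x n| <= M]mulr1 -[M in `|q x n| <= M]mulr1.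
split.
- by apply: le_M (pM x n Kx) => //; rewrite /M; lra.
- by apply: le_M (qM x n Kx) => //; rewrite /M; lra.
- have H1 := He' x n Kx; have H2 := dM x n Kx; rewrite expr1 in H2.
  have H3 : `|q0 x n| <= `|q x n - q0 x n| + `|q x n|.
    by rewrite distrC -{1}(subrK (q x n) (q0 x n)) ler_normD.
  have H4 : `|q x n - q0 x n| <= M * w n by apply: le_M H2 => //; rewrite /M; lra.
  lra.
- by apply: le_M (rM x n Kx) => //; rewrite ?exprn_ge0 // /M; lra.
- by apply: le_M (iM x n Kx) => //; rewrite ?exprn_ge0 // /M; lra.
Qed.
End Riccati.

End OrderCalculus.
(** * The invariant form of a Moebius action *)

Section Energy.
Context {R : realType}.
Implicit Types (a b c d p q v M e : R).

Lemma norm_le_near (x y D M : R) : `|x - y| <= D -> `|y| <= M ->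
  `|x| <= M + D.
Proof.
move=> xyD yM; rewrite -(subrK y x) addrC.
exact: le_trans (ler_normD _ _) (lerD yM xyD).
Qed.

Lemma norm_ge_near (x y D e : R) : `|x - y| <= D -> e <= `|y| -> e - D <= `|x|.
Proof.
move=> xyD ey; rewrite lerBlDr; apply: le_trans ey _.
by apply: norm_le_near (lexx _); rewrite distrC.
Qed.

(** [|v2 - z v1|^2 / Im z] for [z = p + i q].  Keeping the sign of [q] makes it
    covariant under all invertible matrices and spares any discussion of the
    sign of [Im z]. *)
Definition mobius_form p q v1 v2 := ((v2 - p * v1) ^+ 2 + (q * v1) ^+ 2) / q.

Lemma mobius_form_lb M e : 0 < e -> 0 <= M -> exists2 C, 0 < C &
  forall p q v1 v2, `|p| <= M -> `|q| <= M -> e <= `|q| ->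
  v1 ^+ 2 + v2 ^+ 2 <= C * `|mobius_form p q v1 v2|.
Proof.
move=> e0 M0; have e2 : 0 < e ^+ 2 by rewrite exprn_gt0.
have M2 := sqr_ge0 M.
have h1 : 0 <= (1 + 2 * M ^+ 2) / e ^+ 2 by rewrite divr_ge0 ?exprn_ge0 ?ltW //; lra.
exists ((2 + (1 + 2 * M ^+ 2) / e ^+ 2) * (M + 1)).
  by rewrite mulr_gt0 //; lra.
move=> p q v1 v2 pM qM eq; have q0 : 0 < `|q| by lra.
rewrite /mobius_form normrM normfV mulrA ler_pdivlMr //.
rewrite ger0_norm ?addr_ge0 ?sqr_ge0 //.
have qe : e ^+ 2 <= q ^+ 2.
  by rewrite -(real_normK (num_real q)) lerXn2r ?nnegrE // ltW.
have pM2 : p ^+ 2 <= M ^+ 2.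
  by rewrite -(real_normK (num_real p)) lerXn2r ?nnegrE.
have qM1 : `|q| <= M + 1 by lra.
rewrite [_ * _ * (_ + _)]mulrAC; apply: ler_pM => //.
  by rewrite addr_ge0 ?sqr_ge0.
rewrite mulrDl mulrDr -addrA.
have h2 : (1 + 2 * M ^+ 2) * v1 ^+ 2 <= (1 + 2 * M ^+ 2) / e ^+ 2 * (q * v1) ^+ 2.
  rewrite [in leRHS]mulrAC ler_pdivlMr // exprMn -mulrA ler_wpM2l //; first by nra.
  by rewrite mulrC ler_wpM2r ?sqr_ge0.
have h3 := sqr_ge0 (v2 - p * v1); have h4 := sqr_ge0 v1.
have h5 : v2 ^+ 2 <= 2 * (v2 - p * v1) ^+ 2 + 2 * M ^+ 2 * v1 ^+ 2.
  have h6 : p ^+ 2 * v1 ^+ 2 <= M ^+ 2 * v1 ^+ 2 by rewrite ler_wpM2r.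
  by have := sqr_ge0 (v2 - 2 * (p * v1)); nra.
have h7 : 0 <= (1 + 2 * M ^+ 2) / e ^+ 2 * (v2 - p * v1) ^+ 2 by rewrite mulr_ge0.
have h8 : 0 <= 2 * (q * v1) ^+ 2 by rewrite mulr_ge0 ?sqr_ge0.
lra.
Qed.

Lemma mobius_form_ub M e : 0 < e -> 0 <= M -> exists2 C, 0 < C &
  forall p q v1 v2, `|p| <= M -> `|q| <= M -> e <= `|q| ->
  `|mobius_form p q v1 v2| <= C * (v1 ^+ 2 + v2 ^+ 2).
Proof.
move=> e0 M0; exists ((2 + 3 * M ^+ 2) / e).
  by rewrite divr_gt0 //; have := sqr_ge0 M; lra.
move=> p q v1 v2 pM qM eq; have q0 : 0 < `|q| by lra.
rewrite /mobius_form normrM normfV ler_pdivrMr // ger0_norm ?addr_ge0 ?sqr_ge0 //.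
have pM2 : p ^+ 2 <= M ^+ 2.
  by rewrite -(real_normK (num_real p)) lerXn2r ?nnegrE.
have qM2 : q ^+ 2 <= M ^+ 2.
  by rewrite -(real_normK (num_real q)) lerXn2r ?nnegrE.
apply: (@le_trans _ _ ((2 + 3 * M ^+ 2) * (v1 ^+ 2 + v2 ^+ 2))).
  have h4 := sqr_ge0 v1; have h5 := sqr_ge0 v2; have h0 := sqr_ge0 M.
  have h6 : p ^+ 2 * v1 ^+ 2 <= M ^+ 2 * v1 ^+ 2 by rewrite ler_wpM2r.
  have h7 : q ^+ 2 * v1 ^+ 2 <= M ^+ 2 * v1 ^+ 2 by rewrite ler_wpM2r.
  have h8 : 0 <= M ^+ 2 * v2 ^+ 2 by rewrite mulr_ge0.
  by have := sqr_ge0 (v2 + p * v1); rewrite exprMn; nra.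
rewrite -[leRHS]mulrA -mulrA ler_wpM2l //; first by have := sqr_ge0 M; lra.
rewrite [_^-1 * _]mulrC -mulrA ler_peMr ?addr_ge0 ?sqr_ge0 //.
by rewrite ler_pdivlMr ?mul1r.
Qed.

Lemma mobius_form_lipschitz M e : 0 < e -> 0 <= M -> exists2 C, 0 < C &
  forall p q p' q' v1 v2, `|p| <= M -> `|q| <= M -> e <= `|q| ->
  `|p'| <= M -> `|q'| <= M -> e <= `|q'| ->
  `|mobius_form p q v1 v2 - mobius_form p' q' v1 v2|
    <= C * (`|p - p'| + `|q - q'|) * (v1 ^+ 2 + v2 ^+ 2).
Proof.
move=> e0 M0; exists ((1 + 2 * M) / e + (2 * (1 + M ^+ 2)) / e ^+ 2 + 1).
  by rewrite ltr_wpDl // addr_ge0 // divr_ge0 ?exprn_ge0 ?ltW //; have := sqr_ge0 M; lra.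
move=> p q p' q' v1 v2 pM qM eq pM' qM' eq'.
have q0 : 0 < `|q| by lra. have q0' : 0 < `|q'| by lra.
have qn : q != 0 by rewrite -normr_gt0. have qn' : q' != 0 by rewrite -normr_gt0.
set V := v1 ^+ 2 + v2 ^+ 2.
have V0 : 0 <= V by rewrite addr_ge0 ?sqr_ge0.
have v1V : v1 ^+ 2 <= V by rewrite lerDl sqr_ge0.
have v2V : v2 ^+ 2 <= V by rewrite lerDr sqr_ge0.
have qi : `|q^-1| <= e^-1 by rewrite normfV lef_pV2.
have qi' : `|q'^-1| <= e^-1 by rewrite normfV lef_pV2.
have -> : mobius_form p q v1 v2 - mobius_form p' q' v1 v2 =
   (p' - p) * (v1 * v2 * 2 - (p + p') * v1 ^+ 2) * q^-1
   + (v2 - p' * v1) ^+ 2 * ((q' - q) * (q^-1 * q'^-1)) + (q - q') * v1 ^+ 2.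
  by rewrite /mobius_form; field; rewrite ?qn ?qn'.
have ab2 : `|v1 * v2 * 2| <= V.
  rewrite ler_norml /V; have := sqr_ge0 (v1 - v2); have := sqr_ge0 (v1 + v2).
  by move=> *; apply/andP; split; nra.
have t1 : `|(p' - p) * (v1 * v2 * 2 - (p + p') * v1 ^+ 2) * q^-1|
    <= `|p - p'| * ((1 + 2 * M) * V) * e^-1.
  rewrite 2!normrM (distrC p') ler_pM // ?mulr_ge0 // ler_wpM2l //.
  rewrite [leRHS]mulrDl mul1r (le_trans (ler_normB _ _)) // lerD // normrM.
  rewrite ler_pM // ?(ger0_norm (sqr_ge0 v1)) //.
  by rewrite (le_trans (ler_normD _ _)) //; lra.
have t2 : `|(v2 - p' * v1) ^+ 2 * ((q' - q) * (q^-1 * q'^-1))|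
    <= (2 * (1 + M ^+ 2) * V) * (`|q - q'| * (e^-1 * e^-1)).
  rewrite normrM ler_pM //; last first.
    by rewrite normrM (distrC q') ler_wpM2l // normrM ler_pM.
  rewrite ger0_norm ?sqr_ge0 //.
  have pM2 : p' ^+ 2 <= M ^+ 2.
    by rewrite -(real_normK (num_real p')) lerXn2r ?nnegrE.
  have h6 : p' ^+ 2 * v1 ^+ 2 <= M ^+ 2 * V by rewrite ler_pM ?sqr_ge0.
  by have := sqr_ge0 (v2 + p' * v1); nra.
have t3 : `|(q - q') * v1 ^+ 2| <= `|q - q'| * V.
  by rewrite normrM ler_wpM2l // ger0_norm ?sqr_ge0.
apply: le_trans (ler_normD _ _) _; apply: le_trans (lerD (ler_normD _ _) (lexx _)) _.
apply: le_trans (lerD (lerD t1 t2) t3) _.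
have k1 : 0 <= (1 + 2 * M) / e by rewrite divr_ge0 ?ltW //; lra.
have k2 : 0 <= 2 * (1 + M ^+ 2) / e ^+ 2.
  by rewrite divr_ge0 ?exprn_ge0 ?ltW //; have := sqr_ge0 M; lra.
have -> : `|p - p'| * ((1 + 2 * M) * V) / e = ((1 + 2 * M) / e) * `|p - p'| * V.
  by ring.
have -> : 2 * (1 + M ^+ 2) * V * (`|q - q'| * (e^-1 / e))
    = (2 * (1 + M ^+ 2) / e ^+ 2) * `|q - q'| * V by rewrite -exprVn; ring.
rewrite -!mulrDl ler_wpM2r //.
move: (normr_ge0 (p - p')) (normr_ge0 (q - q')) k1 k2.
move: `|_ - _| `|_ - _| (_ / _) (_ / _) => P Q x y P0 Q0 x0 y0.
have := mulr_ge0 x0 Q0; have := mulr_ge0 y0 P0; lra.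
Qed.

(** With [z = p + i q] and [X . z = (c + d z) / (a + b z)], of denominator
    [A + i Q]: the linear form [v2 - (X . z) v1] evaluated at [X v] is
    [det X * (v2 - z v1) / (a + b z)], and [Im (X . z)] is
    [det X * Im z / |a + b z|^2]. *)
Lemma mobius_form_invariant a b c d p q v1 v2 :
  let A := a + b * p in let Q := b * q in let N := A ^+ 2 + Q ^+ 2 in
  N != 0 -> q != 0 -> a * d - b * c != 0 ->
  mobius_form (((c + d * p) * A + d * q * Q) / N) (q * (a * d - b * c) / N)
    (a * v1 + b * v2) (c * v1 + d * v2) = (a * d - b * c) * mobius_form p q v1 v2.
Proof.
move=> A Q N N0 q0 D0; rewrite /N /A /Q in N0 *; rewrite /mobius_form.
by field; rewrite q0 D0 N0.
Qed.

(** If [z1 = p1 + i q1] is close to [X . z], the exact covariance at [X . z] and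
    the Lipschitz dependence of the form on its parameter compare the form of
    [z1] at [X v] with [det X] times the form of [z] at [v].  The distance
    between [z1] and [X . z] is the defect [gr + i gi] divided by [a + b z],
    whose modulus is at least [|b| |Im z|]. *)
Lemma mobius_form_step M e e' : 0 < e -> 0 < e' -> 0 <= M -> exists L h,
  [/\ 0 < L, 0 < h & forall a b c d p q p1 q1 v1 v2 : R,
    let gr := c + d * p - p1 * (a + b * p) + q1 * (b * q) in
    let gi := d * q - q1 * (a + b * p) - p1 * (b * q) in
    [/\ `|a| <= M, `|b| <= M, e' <= `|b| & a * d - b * c != 0] ->
    [/\ `|p| <= M, `|q| <= M & e <= `|q|] ->
    [/\ `|p1| <= M, `|q1| <= M & e <= `|q1|] ->
    `|gr| + `|gi| <= h ->
    `|mobius_form p1 q1 (a * v1 + b * v2) (c * v1 + d * v2)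
       - (a * d - b * c) * mobius_form p q v1 v2|
    <= L * (`|gr| + `|gi|) * `|(a * d - b * c) * mobius_form p q v1 v2| ].
Proof.
move=> e0 e'0 M0.
have e2 : 0 < e / 2 by lra. have Me : 0 <= M + e by lra.
have ee : e / 2 <= e by lra. have eE : e - e / 2 = e / 2 by field.
have MMe : M <= M + e by rewrite lerDl ltW.
have [C1 C1p lb] := mobius_form_lb e2 Me; have [C2 C2p lip] := mobius_form_lipschitz e2 Me.
pose S := M + M ^+ 2; pose n0 := (e' * e) ^+ 2.
have n00 : 0 < n0 by rewrite exprn_gt0 ?mulr_gt0.
have S0 : 0 <= S by rewrite addr_ge0 ?sqr_ge0.
pose D := (S + 1) / n0; have D0 : 0 < D by rewrite divr_gt0 //; lra.
exists (C2 * (2 * D) * C1), (e / (2 * D)); split.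
- by rewrite mulr_gt0 // mulr_gt0 // mulr_gt0.
- by rewrite divr_gt0 // mulr_gt0.
move=> a b c d p q p1 q1 v1 v2 gr gi [aM bM eb det0] [pM qM eq] [p1M q1M eq1] gh.
have q0 : q != 0 by rewrite -normr_gt0 (lt_le_trans e0).
pose A := a + b * p; pose Q := b * q; pose N := A ^+ 2 + Q ^+ 2.
have bpM : `|b * p| <= M ^+ 2 by rewrite normrM expr2 ler_pM.
have AS : `|A| <= S by rewrite (le_trans (ler_normD _ _)) ?lerD.
have QS : `|Q| <= S.
  by rewrite normrM (le_trans (ler_pM _ _ bM qM)) // /S expr2; lra.
have Nn0 : n0 <= N.
  rewrite (@le_trans _ _ (Q ^+ 2)) // /N ?lerDr ?sqr_ge0 // /n0.
  rewrite -(real_normK (num_real Q)) lerXn2r ?nnegrE ?mulr_ge0 ?(ltW e0) ?(ltW e'0) //.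
  by rewrite normrM ler_pM ?(ltW e0) ?(ltW e'0).
have N0 : 0 < N by exact: lt_le_trans n00 Nn0.
have NV : `|N^-1| <= n0^-1.
  by rewrite ger0_norm ?invr_ge0 ?(ltW N0) // lef_pV2.
(* [pt + i qt] is the image [X . z]. *)
pose pt := ((c + d * p) * A + d * q * Q) / N.
pose qt := q * (a * d - b * c) / N.
have mob := @mobius_form_invariant a b c d p q v1 v2.
rewrite /= -/A -/Q -/N in mob.
have {}mob := mob (lt0r_neq0 N0) q0 det0; rewrite -/pt -/qt in mob.
have bnd x y : `|x * A + y * Q| * `|N^-1| <= D * (`|x| + `|y|).
  apply: (@le_trans _ _ ((S * (`|x| + `|y|)) * n0^-1)).
    apply: ler_pM => //; apply: le_trans (ler_normD _ _) _.
    rewrite [leRHS]mulrDr 2!normrM ![S * _]mulrC.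
    by apply: lerD; rewrite ler_wpM2l.
  rewrite mulrAC ler_wpM2r ?addr_ge0 // /D ler_wpM2r ?invr_ge0 ?(ltW n00) //.
  by rewrite lerDl.
have ptE : `|pt - p1| <= D * (`|gr| + `|gi|).
  rewrite (le_trans _ (bnd gr gi)) // -normrM le_eqVlt; apply/orP; left.
  apply/eqP; congr `|_|; move: (lt0r_neq0 N0).
  by rewrite /pt /gr /gi /N /A /Q => N0'; field.
have qtE : `|qt - q1| <= D * (`|gr| + `|gi|).
  have := bnd gi (- gr); rewrite normrN [in leRHS]addrC; apply: le_trans.
  rewrite -normrM le_eqVlt; apply/orP; left.
  apply/eqP; congr `|_|; move: (lt0r_neq0 N0).
  by rewrite /qt /gr /gi /N /A /Q => N0'; field.
have gD : D * (`|gr| + `|gi|) <= e / 2.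
  have D2 : 0 < 2 * D by rewrite mulr_gt0.
  by move: gh; rewrite (ler_pdivlMr _ _ D2) ler_pdivlMr // mulrAC [D * 2]mulrC [leLHS]mulrC.
have ptM : `|pt| <= M + e.
  exact: le_trans (norm_le_near (le_trans ptE gD) p1M) (lerD (lexx _) ee).
have qtM : `|qt| <= M + e.
  exact: le_trans (norm_le_near (le_trans qtE gD) q1M) (lerD (lexx _) ee).
have eqt : e / 2 <= `|qt|.
  by rewrite -{1}eE; exact: norm_ge_near (le_trans qtE gD) eq1.
rewrite -mob.
apply: le_trans (lip p1 q1 pt qt _ _ (le_trans p1M MMe) (le_trans q1M MMe)
  (le_trans ee eq1) ptM qtM eqt) _.
set V := _ ^+ 2 + _ ^+ 2.
have V0 : 0 <= V by rewrite addr_ge0 ?sqr_ge0.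
have lbV : V <= C1 * `|mobius_form pt qt (a * v1 + b * v2) (c * v1 + d * v2)| by exact: lb.
apply: (@le_trans _ _ (C2 * (2 * D * (`|gr| + `|gi|))
    * (C1 * `|mobius_form pt qt (a * v1 + b * v2) (c * v1 + d * v2)|))).
  apply: ler_pM => //; first by rewrite mulr_ge0 ?addr_ge0 // (ltW C2p).
  rewrite ler_wpM2l ?(ltW C2p) // -mulrA mulr_natl mulr2n.
  by rewrite lerD // distrC.
by rewrite le_eqVlt; apply/orP; left; apply/eqP; ring.
Qed.
End Energy.
(** * Energies with summable relative variation *)

Section SummableTails.
Context {R : realType}.
Implicit Types (w : nat -> R).

Lemma summable_tail w (S e : R) : (forall n, 0 <= w n) ->
  (forall n, \sum_(k < n) w k <= S) -> 0 < e ->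
  exists n0, forall n, \sum_(k < n) w (n0 + k)%N <= e.
Proof.
move=> w0 wS e0; pose A := range (fun n => \sum_(k < n) w k).
have supA : has_sup A.
  by split; [exists (\sum_(k < 0) w k), 0%N|exists S => _ [n _ <-]].
have [_ [n0 _ <-] n0e] := sup_adherent e0 supA.
exists n0 => n; have : \sum_(k < n0 + n) w k <= sup A.
  by apply: ub_le_sup; [case: supA|exists (n0 + n)%N].
by rewrite big_split_ord /=; move: n0e; lra.
Qed.

(** While [E] stays below twice its initial value, its total variation is at
    most twice the sum of [eps] times the initial value, that is, at most half
    of it; so it never leaves that range. *)
Lemma quasi_constant (E eps : nat -> R) :
  (forall n, 0 <= eps n) -> (forall n, \sum_(k < n) eps k <= 4^-1) ->
  (forall n, `|E n.+1 - E n| <= eps n * `|E n|) ->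
  forall n, `|E n - E 0%N| <= `|E 0%N| / 2.
Proof.
move=> eps0 epsS dE n.
suff : `|E n - E 0%N| <= 2 * (\sum_(k < n) eps k) * `|E 0%N|.
  move=> /le_trans; apply; have := epsS n; have := normr_ge0 (E 0%N).
  by move: `|_| (\sum_(_ < _) _) => x y; nra.
elim: n => [|n IH]; first by rewrite subrr normr0 big_ord0 mulr0 mul0r.
rewrite big_ord_recr /=.
have En : `|E n| <= 2 * `|E 0%N|.
  have H := norm_le_near IH (lexx _).
  have := epsS n; have := normr_ge0 (E 0%N); move: H.
  move: `|E 0%N| `|E n| (\sum_(_ < _) _) => x y s; nra.
have H : `|E n.+1 - E 0%N| <= `|E n.+1 - E n| + `|E n - E 0%N|.
  by apply: le_trans (ler_normD _ _); rewrite addrA subrK.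
have H1 : eps n * `|E n| <= eps n * (2 * `|E 0%N|) by rewrite ler_wpM2l.
have := dE n; lra.
Qed.
End SummableTails.

Section EnergyBounds.
Context {R : realType} {T : Type}.
Variables (K : set T) (w : nat -> R) (B : R).
Hypotheses (w_ge0 : forall n, 0 <= w n) (w_le : forall n, w n <= B)
  (w_shift : forall n, w n.+1 <= B * w n).

(** Abstract form of the theorem, for recurrences [v_(n+1) = X_n v_n] whose
    matrices are uniformly elliptic and have entries of order 0: the energy
    [al_n F_(z_n) (v_n)], for the approximate solution [z] of the Riccati
    recurrence, is almost constant from some index [n0] on that does not depend
    on [x]. *)
Lemma perturbed_elliptic_bounds (a b c d : T -> nat -> R) (r : nat) (e S : R)
    (al : nat -> R) : (0 < r)%N -> (forall n, \sum_(k < n) w k ^+ r <= S) ->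
  Ord K w r 0 a -> Ord K w r 0 b -> Ord K w r 0 c -> Ord K w r 0 d -> 0 < e ->
  (forall x n, K x -> discr_seq a b c d x n <= - e) ->
  (forall n, 0 < al n) ->
  (forall x n, K x -> al n.+1 * (a x n * d x n - b x n * c x n) = al n) ->
  exists n0 C, 0 < C /\ forall x, K x -> forall v1 v2 : nat -> R,
    (forall n, v1 n.+1 = a x n * v1 n + b x n * v2 n) ->
    (forall n, v2 n.+1 = c x n * v1 n + d x n * v2 n) ->
    forall n, let g n := al n * (v1 n ^+ 2 + v2 n ^+ 2) in
    g n0 <= C * g (n0 + n)%N /\ g (n0 + n)%N <= C * g n0.
Proof.
move=> r0 wS Ha Hb Hc Hd e0 disc_le al0 alE.
have [p [q [M1 [e1 [e10 M10 pqP]]]]] :=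
  approx_riccati w_ge0 w_le w_shift Ha Hb Hc Hd e0 disc_le r0.
have [e2 e20 be] := offdiag_bounded_away w_ge0 Hc e0 disc_le.
have [Ma [Ma0 aM]] := dominated_ge0 w_ge0 (Ord_dominated Ha).
have [Mb [Mb0 bM]] := dominated_ge0 w_ge0 (Ord_dominated Hb).
pose M := Ma + Mb + M1; have M0 : 0 <= M by rewrite /M; lra.
have [MaM MbM M1M] : [/\ Ma <= M, Mb <= M & M1 <= M] by split; rewrite /M; lra.
have eh : 0 < e1 / 2 by lra.
have [L [h [L0 h0 step]]] := mobius_form_step eh e20 M0.
have [C1 C10 lb] := mobius_form_lb eh M0; have [C2 C20 ub] := mobius_form_ub eh M0.
pose t := e1 / (2 * M1 + 1); have t0 : 0 < t by rewrite divr_gt0 //; lra.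
have M1t : M1 * t <= e1 / 2 by rewrite /t mulrA ler_pdivrMr; nra.
have e1E : e1 - e1 / 2 = e1 / 2 by field.
pose M2 := 2 * M1 + 1; have M20 : 0 < M2 by rewrite /M2; lra.
(* A tail of [w ^ r] below [eta] keeps [w] below [t], hence [Im z] away from 0;
   it keeps the defect below the threshold [h] of [mobius_form_step], and the
   relative errors below the total of 1/4 required by [quasi_constant]. *)
pose eta := Num.min (t ^+ r) (Num.min (h / M2) (4^-1 / (L * M2))).
have detP x n : K x -> 0 < a x n * d x n - b x n * c x n.
  move=> Kx; have := disc_le x n Kx; rewrite /discr_seq.
  by have := sqr_ge0 (a x n + d x n); lra.
have eta0 : 0 < eta by rewrite !lt_min exprn_gt0 // !divr_gt0 ?mulr_gt0.
have wr0 n : 0 <= w n ^+ r by rewrite exprn_ge0.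
have [n0 n0P] := summable_tail wr0 wS eta0.
have wrn n : w (n0 + n)%N ^+ r <= eta.
  apply: le_trans (n0P n.+1); rewrite big_ord_recr /= lerDr.
  by apply: sumr_ge0 => k _.
exists n0, (2 * C1 * C2); split; first by rewrite !mulr_gt0.
move=> x Kx v1 v2 v1E v2E n g.
pose E n := al (n0 + n)%N * mobius_form (p x (n0 + n)%N) (q x (n0 + n)%N)
              (v1 (n0 + n)%N) (v2 (n0 + n)%N).
have pqM m : [/\ `|p x (n0 + m)%N| <= M, `|q x (n0 + m)%N| <= M
     & e1 / 2 <= `|q x (n0 + m)%N| ].
  have [pM qM qe _ _] := pqP x (n0 + m)%N Kx.
  split; [exact: le_trans pM M1M|exact: le_trans qM M1M|].
  have wt : w (n0 + m)%N <= t.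
    rewrite -(ler_pXn2r r0) ?nnegrE ?(ltW t0) //.
    by apply: le_trans (wrn m) _; rewrite /eta ge_min lexx.
  apply: le_trans qe; rewrite -{1}e1E lerD2l lerN2.
  exact: le_trans (ler_wpM2l M10 wt) M1t.
have dE m : `|E m.+1 - E m| <= L * M2 * w (n0 + m)%N ^+ r * `|E m|.
  set k := (n0 + m)%N.
  have [_ _ _ rM iM] := pqP x k Kx.
  have H1 : [/\ `|a x k| <= M, `|b x k| <= M, e2 <= `|b x k|
      & a x k * d x k - b x k * c x k != 0].
    have := aM x k Kx; have := bM x k Kx; rewrite !expr0 !mulr1 => H1 H2.
    split; [exact: le_trans H2 MaM|exact: le_trans H1 MbM|exact: be|].
    by apply: lt0r_neq0; exact: detP.
  have H2 := pqM m.+1; rewrite addnS -/k in H2.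
  have grM : `|ric_re a b c d p q x k| + `|ric_im a b c d p q x k|
      <= M2 * w k ^+ r.
    apply: le_trans (lerD rM iM) _; rewrite -mulr2n -mulr_natl mulrA.
    by rewrite ler_wpM2r // lerDl.
  have Gh : `|ric_re a b c d p q x k| + `|ric_im a b c d p q x k| <= h.
    apply: le_trans grM _; rewrite mulrC -ler_pdivlMr //.
    by apply: le_trans (wrn m) _; rewrite /eta !ge_min lexx orbT.
  have {}step := step _ _ _ _ _ _ _ _ (v1 k) (v2 k) H1 (pqM m) H2 Gh.
  rewrite /= -v1E -v2E in step.
  rewrite /E addnS -/k -(alE x k Kx) -(mulrA (al k.+1)) -mulrBr.
  rewrite !(normrM (al k.+1)) [leRHS]mulrCA.
  rewrite ler_wpM2l //; apply: le_trans step _.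
  by rewrite ler_wpM2r // -mulrA ler_wpM2l // ltW.
have epsS m : \sum_(k < m) (L * M2 * w (n0 + k)%N ^+ r) <= 4^-1.
  rewrite -mulr_sumr mulrC -ler_pdivlMr ?mulr_gt0 //.
  by apply: le_trans (n0P m) _; rewrite /eta !ge_min lexx !orbT.
have eps0 m : 0 <= L * M2 * w (n0 + m)%N ^+ r.
  by rewrite !mulr_ge0 ?(ltW L0) ?(ltW M20).
have En := quasi_constant eps0 epsS dE n.
have EgP m : `|E m| <= C2 * g (n0 + m)%N /\ g (n0 + m)%N <= C1 * `|E m|.
  have [H1 H2 H3] := pqM m; have al0' := al0 (n0 + m)%N.
  rewrite /E /g normrM (gtr0_norm al0') [in C1 * _]mulrCA [in C2 * _]mulrCA.
  by rewrite !ler_pM2l ?lb ?ub.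
have [E0u E0l] := EgP 0%N; have [Enu Enl] := EgP n.
rewrite addn0 in E0u E0l.
have En0 : `|E n| <= 2 * `|E 0%N|.
  apply: le_trans (norm_le_near En (lexx _)) _.
  by have := normr_ge0 (E 0%N); lra.
have E0n : `|E 0%N| <= 2 * `|E n|.
  by have := norm_ge_near En (lexx _); lra.
split.
- apply: le_trans E0l _; rewrite [2 * C1]mulrC -!mulrA ler_wpM2l ?(ltW C10) //.
  by apply: le_trans E0n _; rewrite ler_wpM2l.
- apply: le_trans Enl _; rewrite [2 * C1]mulrC -!mulrA ler_wpM2l ?(ltW C10) //.
  by apply: le_trans En0 _; rewrite ler_wpM2l.
Qed.
End EnergyBounds.
(** * A single weight for all differences *)

Section Majorant.
Context {R : realType}.

(** Take [v n = sum over m >= n of 2 ^ (n - m) * w m], written as [2 ^ n] times a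
    tail of the series of [2 ^ (- m) * w m]. *)
Lemma slowly_varying_majorant (w : nat -> R) (S : R) :
  (forall n, 0 <= w n) -> (forall n, \sum_(k < n) w k <= S) ->
  exists v : nat -> R, [/\ forall n, w n <= v n, forall n, v n <= S,
    forall n, v n.+1 <= 2 * v n & forall n, \sum_(k < n) v k <= 3 * S].
Proof.
move=> w0 wS; pose P n := \sum_(k < n) 2^-1 ^+ k * w k.
have S0 : 0 <= S by have := wS 0%N; rewrite big_ord0.
have h0 k : 0 <= 2^-1 ^+ k :> R by rewrite exprn_ge0.
have hP k : 0 < 2^-1 ^+ k :> R by rewrite exprn_gt0.
have hle k : 2^-1 ^+ k <= 1 :> R by rewrite exprn_ile1 // invf_le1 // ler1n.
have PS n m : P (n + m)%N <= P n + 2^-1 ^+ n * S.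
  rewrite /P big_split_ord /= lerD2l; apply: le_trans (ler_wpM2l (h0 n) (wS (n + m)%N)).
  rewrite [in leRHS]big_split_ord mulrDr /= -[leLHS]add0r lerD //.
    by rewrite mulr_ge0 // sumr_ge0.
  rewrite mulr_sumr ler_sum // => k _; rewrite exprD -mulrA ler_wpM2l //.
  by rewrite ler_piMl.
pose W := sup (range P).
have bP : has_sup (range P).
  split; first by exists (P 0%N), 0%N.
  by exists (P 0%N + 2^-1 ^+ 0 * S) => _ [n _ <-]; have := PS 0%N n; rewrite add0n.
have PW n : P n <= W by apply: ub_le_sup; [case: bP|exists n].
have WP n : W <= P n + 2^-1 ^+ n * S.
  apply: ge_sup; [by case: bP|move=> _ [m _ <-]].
  have [nm|/ltnW mn] := leqP n m; first by rewrite -(subnKC nm).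
  have : P m <= P n.
    rewrite -(subnKC mn) /P big_split_ord /= lerDl sumr_ge0 // => k _.
    by rewrite mulr_ge0.
  by move/le_trans; apply; rewrite lerDl mulr_ge0.
have P1 n : P n.+1 = P n + 2^-1 ^+ n * w n by rewrite /P big_ord_recr.
have p2 n : 2 ^+ n * 2^-1 ^+ n = 1 :> R by rewrite -exprMn mulfV ?expr1n ?pnatr_eq0.
have g0 k : 0 <= 2 ^+ k :> R by rewrite exprn_ge0.
pose v n := 2 ^+ n * (W - P n).
have vw n : w n <= v n.
  have := ler_wpM2l (g0 n) (PW n.+1); rewrite P1 mulrDr mulrA p2 mul1r /v mulrBr.
  lra.
have vS n : v n <= S.
  have := ler_wpM2l (g0 n) (WP n); rewrite mulrDr mulrA p2 mul1r /v mulrBr.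
  lra.
have v1 n : v n.+1 = 2 * (v n - w n).
  rewrite /v P1 exprS.
  transitivity (2 * (2 ^+ n * (W - P n)) - 2 * (2 ^+ n * 2^-1 ^+ n * w n)).
    by ring.
  by rewrite p2; ring.
exists v; split=> // n; first by rewrite v1; have := w0 n; lra.
have -> : \sum_(k < n) v k = 2 * (\sum_(k < n) w k) - v 0%N + v n.
  elim: n => [|n IH]; first by rewrite !big_ord0; ring.
  by rewrite !big_ord_recr /= IH v1; ring.
by have := wS n; have := vS n; have := vw 0%N; have := w0 0%N; lra.
Qed.

Lemma DeltaS {V : zmodType} j (A : nat -> V) n :
  Delta j.+1 A n = Delta j (fun k => A k.+1 - A k) n.
Proof. by elim: j n => [|j IH] n //=; rewrite -!IH. Qed.

Lemma Delta_shift {V : zmodType} j (A : nat -> V) n :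
  Delta j (fun k => A k.+1) n = Delta j A n.+1.
Proof. by elim: j n => [|j IH] n //=; rewrite !IH. Qed.

Lemma Delta_entry j m n (A : nat -> 'M[R]_(m, n)) k i l :
  Delta j A k i l = Delta j (fun k => A k i l) k.
Proof. by elim: j k => [|j IH] k //=; rewrite !mxE !IH. Qed.

Lemma norm_entry m n (A : 'M[R]_(m, n)) i l : `|A i l| <= `|A|.
Proof.
rewrite [leRHS]mx_normrE.
exact: (le_bigmax _ (fun ij : 'I_m * 'I_n => `|A ij.1 ij.2|) (i, l)).
Qed.

Lemma Ord_Delta T (K : set T) (w : nat -> R) m k (f : T -> nat -> R) :
  (forall j, (j <= m)%N -> dominated K w (k + j) (fun x n => Delta j (f x) n)) ->
  Ord K w m k f.
Proof.
elim: m k f => [|m IH] k f H; split=> //;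
  try by have := H 0%N isT; rewrite addn0.
apply: IH => j jm; rewrite addSnnS; have [C HC] := H j.+1 jm.
by exists C => x n Kx; have := HC x n Kx; rewrite DeltaS.
Qed.

Lemma Ord_shiftn T (K : set T) (w : nat -> R) B m k (f : T -> nat -> R) n0 :
  (forall n, 0 <= w n) -> (forall n, w n <= B) ->
  (forall n, w n.+1 <= B * w n) ->
  Ord K w m k f -> Ord K w m k (fun x n => f x (n0 + n)%N).
Proof.
move=> w0 wB ws; elim: n0 f => [|n0 IH] f // Hf.
exact: (IH (fshift f) (Ord_shift w0 wB ws Hf)).
Qed.

(** Let [w0 n] be the sum over [j] of the suprema of [|Delta^j A|^(r / j)]; it is
    summable, and so is a slowly varying majorant [v] of it.  The weight is
    [w = v ^ (1 / r)]: from [|Delta^j A|^(r / j) <= w ^ r] follows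
    [|Delta^j A| <= w ^ j]. *)
Lemma in_D_majorant r (K : set R) (A : nat -> R -> 'M[R]_2) :
  (0 < r)%N -> in_D r K A -> exists (w : nat -> R) (B S : R),
  [/\ forall n, 0 <= w n, forall n, w n <= B, forall n, w n.+1 <= B * w n,
      forall n, \sum_(k < n) w k ^+ r <= S &
      forall i l, Ord K w r 0 (fun x n => A n.+1 x i l)].
Proof.
move=> r0 [_ _ [M AM] As].
pose s j n : R := sup [set `|Delta j (A ^~ x) n| `^ (r%:R / j%:R) | x in K].
have DM j n x : (1 <= n)%N -> K x -> `|Delta j (A ^~ x) n| <= 2 ^+ j * M.
  elim: j n => [|j IH] n n1 Kx /=; first by rewrite expr0 mul1r AM.
  rewrite (le_trans (ler_normB _ _)) // exprS -mulrA mulr_natl mulr2n.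
  by rewrite lerD // IH // ltnW.
have sub j n x : (1 <= n)%N -> K x ->
    `|Delta j (A ^~ x) n| `^ (r%:R / j%:R) <= s j n.
  move=> n1 Kx; apply: ub_le_sup; last by exists x.
  exists ((2 ^+ j * M) `^ (r%:R / j%:R)) => _ [y Ky <-].
  apply: ge0_ler_powR; rewrite ?divr_ge0 ?ler0n ?nnegrE ?DM //.
  exact: le_trans (normr_ge0 _) (DM j n y n1 Ky).
have s0 j n : 0 <= s j n.
  rewrite /s; set E := [set _ | _ in K].
  have [[[_ [x Kx _]] ubE]|nsE] := pselect (has_sup E); last by rewrite sup_out.
  by apply: le_trans (ub_le_sup ubE (imageP _ Kx)); exact: powR_ge0.
have bs j : (1 <= j <= r)%N -> exists S, forall n, \sum_(k < n) s j k.+1 <= S.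
  move=> jr; have := As j jr; set E := (X in (X < _)%E) => Efin.
  have sE n : ((\sum_(k < n) s j k.+1)%:E <= E)%E.
    have := @nneseries_lim_ge R (fun n => (s j n)%:E) xpredT 1 n.+1.
    rewrite sumEFin big_add1 /= big_mkord; apply=> k _ _; rewrite lee_fin //.
  exists (fine E) => n; rewrite -lee_fin fineK //.
  by rewrite ge0_fin_numE // (le_trans _ (sE 0%N)) // big_ord0.
pose w0 k := \sum_(1 <= j < r.+1) s j k.+1.
have [S wS] : exists S, forall n, \sum_(k < n) w0 k <= S.
  have H m : (m <= r)%N -> exists S, forall n,
      \sum_(k < n) \sum_(1 <= j < m.+1) s j k.+1 <= S.
    elim: m => [|m IH] mr.
      by exists 0 => n; rewrite big1 // => k _; rewrite big_geq.
    have [S1 H1] := IH (ltnW mr); have [|S2 H2] := bs m.+1; first by lia.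
    exists (S1 + S2) => n.
    under eq_bigr do rewrite big_nat_recr //=.
    by rewrite big_split /= lerD ?H1 ?H2.
  exact: H.
have w00 n : 0 <= w0 n by rewrite /w0 sumr_ge0.
have [v [wv vS v2 vsum]] := slowly_varying_majorant w00 wS.
have v0 n : 0 <= v n by exact: le_trans (w00 n) (wv n).
have rn : r%:R != 0 :> R by rewrite pnatr_eq0 -lt0n.
pose w n := v n `^ r%:R^-1.
have wr n : w n ^+ r = v n.
  by rewrite -powR_mulrn ?powR_ge0 // -powRrM mulVf // powRr1.
have wp n : 0 <= w n by exact: powR_ge0.
have S0 : 0 <= S by exact: le_trans (v0 0%N) (vS 0%N).
have le_root x y : 0 <= y -> x ^+ r <= y ^+ r -> 0 <= x -> x <= y.
  by move=> y0 + x0; rewrite ler_pXn2r.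
have wB n : w n <= 2 + S.
  apply: le_root => //; first by lra.
  rewrite wr; apply: le_trans (vS n) _; apply: (@le_trans _ _ (2 + S)); first by lra.
  by apply: ler_eXnr => //; lra.
exists w, (2 + S), (3 * S); split=> //.
- move=> n; apply: (@le_trans _ _ (2 * w n)); last by rewrite ler_wpM2r //; lra.
  apply: le_root => //; first by rewrite mulr_ge0.
  rewrite exprMn !wr; apply: le_trans (v2 n) _; rewrite ler_wpM2r //.
  by apply: ler_eXnr => //; lra.
- by move=> n; under eq_bigr do rewrite wr.
move=> i l; apply: Ord_Delta => j jr; rewrite add0n.
case: j jr => [|j] jr.
  exists M => x n Kx; rewrite expr0 mulr1 /=.
  exact: le_trans (norm_entry _ _ _) (AM _ _ _ Kx).
exists 1 => x n Kx; rewrite mul1r.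
rewrite (Delta_shift j.+1 (fun k => A k x i l)) -(Delta_entry _ (fun k => A k x)).
apply: le_trans (norm_entry _ _ _) _; rewrite leNgt; apply/negP => H.
have j0 : 0 < r%:R / j.+1%:R :> R by rewrite divr_gt0 ?ltr0n.
have := gt0_ltr_powR j0 _ _ H; rewrite !nnegrE exprn_ge0 // normr_ge0.
move=> /(_ isT isT); rewrite -(powR_mulrn j.+1 (wp n)) -powRrM mulrCA mulfV.
  rewrite mulr1 powR_mulrn // wr ltNge => /negP; apply.
  apply: le_trans (sub j.+1 n.+1 x isT Kx) _; apply: le_trans (wv n).
  rewrite /w0 (big_rem j.+1) /=; last by rewrite mem_index_iota; lia.
  by rewrite lerDl sumr_ge0.
by rewrite pnatr_eq0.
Qed.
End Majorant.
(** * Polynomials converging to negative values on a compact set *)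

Section UniformNegativity.
Context {R : realType}.

(** Interpolation by induction on the degree: for [x0] in [K], apply the
    statement on [K] minus [x0] to the quotient of [p - p(x0)] by [X - x0].  The
    sample has fewer than [d] points only when it exhausts [K]. *)
Lemma sampling_formula d (K : set R) : exists l : seq (R * {poly R}),
  (forall y, y \in l -> K y.1) /\
  forall p : {poly R}, (size p <= d)%N -> forall x, K x ->
    p.[x] = \sum_(y <- l) p.[y.1] * y.2.[x].
Proof.
elim: d K => [|d IH] K.
  exists [::]; split=> // p; rewrite leqn0 size_poly_eq0 => /eqP-> x _.
  by rewrite horner0 big_nil.
have [[x0 Kx0]|K0] := pselect (exists x, K x); last first.
  by exists [::]; split=> // p _ x Kx; case: K0; exists x.
have [l [lK lP]] := IH (K `\ x0).
pose D (y : R * {poly R}) := (y.1 - x0)^-1 *: (('X - x0%:P) * y.2).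
have DE y x : (D y).[x] = (y.1 - x0)^-1 * ((x - x0) * y.2.[x]).
  by rewrite hornerZ hornerM hornerXsubC.
exists ((x0, 1 - \sum_(y <- l) D y) :: [seq (y.1, D y) | y <- l]); split.
  move=> y; rewrite inE => /predU1P[->//|/mapP[z zl ->]] /=.
  by have [] := lK z zl.
move=> p sp x Kx.
have /factor_theorem[q pq] : root (p - p.[x0]%:P) x0.
  by rewrite rootE !hornerE subrr.
have pE y : p.[y] = p.[x0] + q.[y] * (y - x0).
  have := congr1 (horner^~ y) pq.
  by rewrite /= hornerM hornerXsubC hornerD hornerN hornerC => <-; rewrite addrC subrK.
have sq : (size q <= d)%N.
  have [->|q0] := eqVneq q 0; first by rewrite size_poly0.
  have sqX : size (q * ('X - x0%:P)) = (size q).+1.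
    by rewrite size_Mmonic ?monicXsubC // size_XsubC addn2.
  rewrite -ltnS -sqX -pq (leq_trans (size_polyD _ _)) // size_polyN geq_max sp.
  by rewrite (leq_trans (size_polyC_leq1 _)).
rewrite big_cons big_map /= hornerD hornerN hornerC horner_sum mulrBr mulr1 mulr_sumr -addrA.
rewrite [in LHS]pE; congr (_ + _).
rewrite addrC -sumrB.
have [->|xx0] := eqVneq x x0.
  by rewrite subrr mulr0 big1 // => y _; rewrite DE subrr mul0r !mulr0 subrr.
rewrite (lP q sq) //; last by split=> //; apply/eqP.
rewrite mulr_suml big_seq [RHS]big_seq; apply: eq_bigr => y yl.
have [Ky yx0] := lK y yl.
rewrite (pE y.1) DE; field.
by rewrite subr_eq0; apply/eqP.
Qed.

Lemma compact_poly_bounded (K : set R) (p : {poly R}) : compact K ->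
  exists C, 0 < C /\ forall x, K x -> `|p.[x]| <= C.
Proof.
move=> cK; have : compact [set p.[x] | x in K].
  by apply: continuous_compact => //; exact/continuous_subspaceT/continuous_horner.
move=> /compact_bounded[M [_ MP]]; exists (`|M| + 1); split.
  by rewrite ltr_wpDl.
move=> x Kx; apply: (MP (`|M| + 1)); last by exists x.
by rewrite (le_lt_trans (ler_norm _)) // ltrDl.
Qed.

Lemma sampled_cvg (K : set R) (l : seq (R * {poly R})) (lam : R -> R)
    (P : nat -> {poly R}) : compact K ->
  (forall y, y \in l -> (P n).[y.1] @[n --> \oo] --> lam y.1) ->
  forall e, 0 < e -> exists n0, forall n, (n0 <= n)%N -> forall x, K x ->
    `|\sum_(y <- l) (P n).[y.1] * y.2.[x] - \sum_(y <- l) lam y.1 * y.2.[x]| <= e.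
Proof.
move=> cK; elim: l => [|y l IH] lP e e0.
  by exists 0%N => n _ x _; rewrite !big_nil subrr normr0 ltW.
have e2 : 0 < e / 2 by lra.
have [|n1 n1P] := IH _ _ e2.
  by move=> z zl; apply: lP; rewrite inE zl orbT.
have [C [C0 yC]] := compact_poly_bounded y.2 cK.
have /cvgrPdist_le/(_ (e / 2 / C)) := lP y (mem_head _ _).
rewrite divr_gt0 // => /(_ isT)[n2 _ n2P].
exists (maxn n1 n2) => n; rewrite geq_max => /andP[nn1 nn2] x Kx.
rewrite !big_cons opprD addrACA (le_trans (ler_normD _ _)) //.
have : `|(P n).[y.1] * y.2.[x] - lam y.1 * y.2.[x]| <= e / 2.
  rewrite -mulrBl normrM; have := n2P n nn2; rewrite /= distrC.
  rewrite ler_pdivlMr // => H; apply: le_trans _ H.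
  by rewrite ler_wpM2l // yC.
have := n1P n nn1 x Kx; lra.
Qed.

(** By the sampling formula pointwise convergence is uniform, and the limit is a
    polynomial; being negative on the compact set [K], it has a negative
    maximum there. *)
Lemma poly_uniformly_negative (K : set R) d (P : nat -> {poly R}) : compact K ->
  (forall n, (size (P n) <= d)%N) ->
  (forall x, K x -> exists l : R, l < 0 /\ (P n).[x] @[n --> \oo] --> l) ->
  exists e n0, 0 < e /\ forall n, (n0 <= n)%N -> forall x, K x -> (P n).[x] <= - e.
Proof.
move=> cK sP Plim.
have [K0|K0] := pselect (exists x, K x); last first.
  by exists 1, 0%N; split=> // n _ x Kx; case: K0; exists x.
have [l [lK lP]] := sampling_formula d K.
pose lam x := lim ((P n).[x] @[n --> \oo]).
have lamP x : K x -> lam x < 0 /\ (P n).[x] @[n --> \oo] --> lam x.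
  by move=> Kx; have [z [z0 zl]] := Plim x Kx; rewrite /lam (cvg_lim _ zl).
have lamc y : y \in l -> (P n).[y.1] @[n --> \oo] --> lam y.1.
  by move=> yl; have [] := lamP _ (lK y yl).
pose Q := \sum_(y <- l) lam y.1 *: y.2.
have QE x : Q.[x] = \sum_(y <- l) lam y.1 * y.2.[x].
  by rewrite /Q horner_sum; under eq_bigr do rewrite hornerZ.
have unif e : 0 < e -> exists n0, forall n, (n0 <= n)%N -> forall x, K x ->
    `|(P n).[x] - Q.[x]| <= e.
  move=> e0; have [n0 n0P] := sampled_cvg cK lamc e0.
  by exists n0 => n nn x Kx; rewrite QE (lP _ (sP n)) // n0P.
have Qneg x : K x -> Q.[x] < 0.
  move=> Kx; have [z0 zl] := lamP x Kx.
  have z4 : 0 < - lam x / 4 by lra.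
  have [n1 n1P] := unif _ z4.
  move/cvgrPdist_le: zl => /(_ _ z4)[n2 _ n2P].
  have := n1P _ (leq_maxl n1 n2) x Kx; have := n2P _ (leq_maxr n1 n2).
  by rewrite /= !ler_norml => /andP[? ?] /andP[? ?]; lra.
have cQ : {within K, continuous (horner Q)}.
  exact/continuous_subspaceT/continuous_horner.
have [m mK mP] := compact_EVT_max K0 cK cQ.
have {mK} mK : K m by rewrite inE in mK.
have e0 : 0 < - Q.[m] / 2 by have := Qneg m mK; lra.
have [n0 n0P] := unif _ e0.
exists (- Q.[m] / 2), n0; split=> // n nn x Kx.
have := n0P n nn x Kx; have := mP x; rewrite inE => /(_ Kx).
by rewrite ler_norml => ? /andP[? ?]; lra.
Qed.

End UniformNegativity.
(** * Transfer matrices and generalized eigenvectors *)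

Section TransferMatrices.
Context {R : realType}.
Implicit Types (a b u : nat -> R) (x : R).

Lemma det_ord2 (X : 'M[R]_2) : \det X = X 0 0 * X 1 1 - X 0 1 * X 1 0.
Proof.
rewrite (expand_det_row _ 0) !big_ord_recl big_ord0 /cofactor !det_mx11 !mxE.
have -> : lift 0 0 = 1 :> 'I_2 by exact/val_inj.
have -> : lift 1 0 = 0 :> 'I_2 by exact/val_inj.
by rewrite /= expr0 expr1; ring.
Qed.

Lemma sum_ord2 (F : 'I_2 -> R) : \sum_(i < 2) F i = F 0 + F 1.
Proof.
rewrite !big_ord_recl big_ord0 addr0.
by have -> : lift 0 0 = 1 :> 'I_2 by exact/val_inj.
Qed.

Lemma discrE (X : 'M[R]_2) :
  discr X = (X 0 0 + X 1 1) ^+ 2 - 4 * (X 0 0 * X 1 1 - X 0 1 * X 1 0).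
Proof. by rewrite /discr det_ord2 /mxtrace sum_ord2. Qed.

Definition poly_fun d (f : R -> R) :=
  exists p : {poly R}, (size p <= d.+1)%N /\ forall x, f x = p.[x].

Lemma poly_funC d c : poly_fun d (fun=> c).
Proof.
exists c%:P; split=> [|x]; last by rewrite hornerC.
by rewrite (leq_trans (size_polyC_leq1 c)).
Qed.

Lemma poly_funD d f g : poly_fun d f -> poly_fun d g ->
  poly_fun d (fun x => f x + g x).
Proof.
move=> [p [sp fp]] [q [sq gq]]; exists (p + q); split=> [|x].
  by rewrite (leq_trans (size_polyD _ _)) // geq_max sp.
by rewrite hornerD fp gq.
Qed.

Lemma poly_funM d e f g : poly_fun d f -> poly_fun e g ->
  poly_fun (d + e) (fun x => f x * g x).
Proof.
move=> [p [sp fp]] [q [sq gq]]; exists (p * q); split=> [|x].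
  by rewrite (leq_trans (size_polyMleq _ _)) //; lia.
by rewrite hornerM fp gq.
Qed.

Lemma transfer_mx_poly a b n i j :
  poly_fun 1 (fun x => transfer_mx a b n x i j).
Proof.
suff : exists p : {poly R}, (size p <= 2)%N /\
    forall x, transfer_mx a b n x i j = p.[x] by [].
case: i => -[|[|//]] ?; case: j => -[|[|//]] ?.
- have [p [sp pE]] := poly_funC 1 0; exists p; split=> // x.
  by rewrite mxE /= -pE.
- have [p [sp pE]] := poly_funC 1 1; exists p; split=> // x.
  by rewrite mxE /= -pE.
- have [p [sp pE]] := poly_funC 1 (- (a n.-1 / a n)); exists p; split=> // x.
  by rewrite mxE /= -pE.
have Xp : poly_fun 1 (fun x => x - b n).
  exists ('X - (b n)%:P); split=> [|x]; last by rewrite hornerXsubC.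
  by rewrite size_XsubC.
have [p [sp pE]] := poly_funM Xp (poly_funC 0 (a n)^-1).
by exists p; split=> // x; rewrite mxE /= -pE.
Qed.

Lemma N_step_poly a b N n i j :
  poly_fun N (fun x => N_step_transfer_mx a b N n x i j).
Proof.
have : size (rev (index_iota n (n + N))) = N.
  by rewrite size_rev size_iota addKn.
rewrite /N_step_transfer_mx; move: (rev _) => s <-.
elim: s i j => [|k s IH] i j /=.
  have [p [sp pE]] := poly_funC 0 ((i == j)%:R : R).
  by exists p; split=> // x; rewrite big_nil mxE -pE.
have T := transfer_mx_poly a b k.
have [p [sp pE]] := poly_funD (poly_funM (T i 0) (IH 0 j)) (poly_funM (T i 1) (IH 1 j)).
by exists p; split=> // x; rewrite big_cons -pE mxE sum_ord2.
Qed.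

Lemma discr_N_step_poly a b N n :
  poly_fun (N + N) (fun x => discr (N_step_transfer_mx a b N n x)).
Proof.
have E i j := N_step_poly a b N n i j.
have S := poly_funD (E 0 0) (E 1 1).
have D := poly_funD (poly_funM (E 0 0) (E 1 1))
  (poly_funM (poly_funC 0 (-1)) (poly_funM (E 0 1) (E 1 0))).
have [p [sp pE]] := poly_funD (poly_funM S S) (poly_funM (poly_funC 0 (-4)) D).
by exists p; split=> // x; rewrite -pE discrE; ring.
Qed.

Lemma transfer_mxE a b n x :
  [/\ transfer_mx a b n x 0 0 = 0, transfer_mx a b n x 0 1 = 1,
      transfer_mx a b n x 1 0 = - (a n.-1 / a n)
    & transfer_mx a b n x 1 1 = (x - b n) / a n].
Proof. by rewrite !mxE. Qed.

Lemma N_stepS a b N n x : N_step_transfer_mx a b N.+1 n x =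
  transfer_mx a b (n + N) x * N_step_transfer_mx a b N n x.
Proof.
rewrite /N_step_transfer_mx addnS /index_iota subSn ?leq_addr // addKn.
by rewrite -[N.+1]addn1 iotaD rev_cat big_cons.
Qed.

Lemma det_N_step a b N n x : (forall n, 0 < a n) -> (0 < n)%N ->
  a (n + N).-1 * \det (N_step_transfer_mx a b N n x) = a n.-1.
Proof.
move=> a0 n0; elim: N => [|N IH].
  rewrite addn0 /N_step_transfer_mx addn0 /index_iota subnn /rev /= big_nil.
  by rewrite det1 mulr1.
rewrite N_stepS detM det_ord2; have [-> -> -> _] := transfer_mxE a b (n + N) x.
rewrite -IH addnS /=; have := lt0r_neq0 (a0 (n + N)%N) => ?.
by field.
Qed.

Lemma N_step_eigenvector a b N n x u : (forall n, 0 < a n) -> (0 < n)%N ->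
  gen_eigenvector a b x u -> let X := N_step_transfer_mx a b N n x in
  u (n + N).-1 = X 0 0 * u n.-1 + X 0 1 * u n /\
  u (n + N)%N = X 1 0 * u n.-1 + X 1 1 * u n.
Proof.
move=> a0 n0 [_ ru] /=; elim: N => [|N [IH0 IH1]].
  rewrite addn0 /N_step_transfer_mx addn0 /index_iota subnn /rev /= big_nil !mxE /=.
  by split; ring.
rewrite N_stepS !mxE !sum_ord2; have [-> -> -> ->] := transfer_mxE a b (n + N) x.
have nN : (1 <= n + N)%N by lia.
have aN := lt0r_neq0 (a0 (n + N)%N).
rewrite addnS /=; split; first by rewrite IH1; ring.
have -> : u (n + N).+1 = - (a (n + N).-1 / a (n + N)%N) * u (n + N).-1
    + (x - b (n + N)%N) / a (n + N)%N * u (n + N)%N.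
  apply: (mulfI aN); have := ru _ nN => H.
  transitivity (x * u (n + N)%N - a (n + N).-1 * u (n + N).-1 - b (n + N)%N * u (n + N)%N).
    by rewrite -H; ring.
  by field.
by rewrite {1}IH0 {1}IH1; ring.
Qed.

Lemma linear_sqr_le (s t p q : R) :
  (s * p + t * q) ^+ 2 <= (s ^+ 2 + t ^+ 2) * (p ^+ 2 + q ^+ 2).
Proof.
have := sqr_ge0 (s * q - t * p); move: s t p q => s t p q H.
have -> : (s ^+ 2 + t ^+ 2) * (p ^+ 2 + q ^+ 2)
  = (s * p + t * q) ^+ 2 + (s * q - t * p) ^+ 2 by ring.
lra.
Qed.

(** The recurrence can be solved for its last and for its first term, with
    coefficients that are bounded because [K] is. *)
Lemma eigenvector_step a b (K : set R) j : (forall n, 0 < a n) -> compact K ->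
  exists C, 0 < C /\ forall x, K x -> forall u, gen_eigenvector a b x u ->
    u j.+1 ^+ 2 + u j.+2 ^+ 2 <= C * (u j ^+ 2 + u j.+1 ^+ 2) /\
    u j ^+ 2 + u j.+1 ^+ 2 <= C * (u j.+1 ^+ 2 + u j.+2 ^+ 2).
Proof.
move=> a0 cK; have [M [M0 KM]] := compact_poly_bounded ('X - (b j.+1)%:P) cK.
have p0 := a0 j; have p1 := a0 j.+1.
pose C1 := 1 + ((a j / a j.+1) ^+ 2 + (M / a j.+1) ^+ 2).
pose C2 := 1 + ((M / a j) ^+ 2 + (a j.+1 / a j) ^+ 2).
have C10 : 0 <= C1 by rewrite !addr_ge0 ?sqr_ge0.
have C20 : 0 <= C2 by rewrite !addr_ge0 ?sqr_ge0.
exists (C1 + C2 + 1); split; first by rewrite ltr_wpDl // addr_ge0.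
move=> x Kx u [_ /(_ j.+1 isT) /= ru].
have xM : `|x - b j.+1| <= M by have := KM x Kx; rewrite hornerXsubC.
have q0 : 0 <= u j ^+ 2 by exact: sqr_ge0.
have q1 : 0 <= u j.+1 ^+ 2 by exact: sqr_ge0.
have q2 : 0 <= u j.+2 ^+ 2 by exact: sqr_ge0.
have xM2 (y : R) : 0 < y -> ((x - b j.+1) / y) ^+ 2 <= (M / y) ^+ 2.
  move=> y0; rewrite !exprMn ler_wpM2r ?sqr_ge0 //.
  by rewrite -(real_normK (num_real (x - _))) lerXn2r ?nnegrE // ltW.
have e2 : u j.+2 = - (a j / a j.+1) * u j + (x - b j.+1) / a j.+1 * u j.+1.
  apply: (mulfI (lt0r_neq0 p1)).
  transitivity (x * u j.+1 - a j * u j - b j.+1 * u j.+1).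
    by rewrite -ru; ring.
  by field; exact: lt0r_neq0.
have e0 : u j = (x - b j.+1) / a j * u j.+1 + - (a j.+1 / a j) * u j.+2.
  apply: (mulfI (lt0r_neq0 p0)).
  transitivity (x * u j.+1 - b j.+1 * u j.+1 - a j.+1 * u j.+2).
    by rewrite -ru; ring.
  by field; exact: lt0r_neq0.
split.
- have H : u j.+2 ^+ 2 <= (C1 - 1) * (u j ^+ 2 + u j.+1 ^+ 2).
    rewrite {1}e2; apply: le_trans (linear_sqr_le _ _ _ _) _.
    rewrite ler_wpM2r ?addr_ge0 // /C1 sqrrN (addrC 1) addrK lerD2l; exact: xM2.
  have := mulr_ge0 C20 (addr_ge0 q0 q1); lra.
- have H : u j ^+ 2 <= (C2 - 1) * (u j.+1 ^+ 2 + u j.+2 ^+ 2).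
    rewrite {1}e0; apply: le_trans (linear_sqr_le _ _ _ _) _.
    rewrite ler_wpM2r ?addr_ge0 // /C2 sqrrN (addrC 1) addrK lerD2r; exact: xM2.
  have := mulr_ge0 C10 (addr_ge0 q1 q2); lra.
Qed.

Lemma eigenvector_initial_bounds a b (K : set R) J :
  (forall n, 0 < a n) -> compact K ->
  exists C, 0 < C /\ forall x, K x -> forall u, gen_eigenvector a b x u ->
    forall j, (j <= J)%N ->
    u 0%N ^+ 2 + u 1%N ^+ 2 <= C * (a j * (u j ^+ 2 + u j.+1 ^+ 2)) /\
    a j * (u j ^+ 2 + u j.+1 ^+ 2) <= C * (u 0%N ^+ 2 + u 1%N ^+ 2).
Proof.
move=> a0 cK.
have q0 (p q : R) : 0 <= p ^+ 2 + q ^+ 2 by rewrite addr_ge0 ?sqr_ge0.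
have H j : exists C, 0 < C /\ forall x, K x ->
    forall u, gen_eigenvector a b x u ->
    u 0%N ^+ 2 + u 1%N ^+ 2 <= C * (u j ^+ 2 + u j.+1 ^+ 2) /\
    (u j ^+ 2 + u j.+1 ^+ 2) <= C * (u 0%N ^+ 2 + u 1%N ^+ 2).
  elim: j => [|j [C [C0 IH]]]; first by exists 1; split=> // x _ u _; rewrite mul1r.
  have [D [D0 HD]] := eigenvector_step b j a0 cK.
  exists (C * D); split; first exact: mulr_gt0.
  move=> x Kx u ux; have [i1 i2] := IH x Kx u ux; have [d1 d2] := HD x Kx u ux.
  split.
    by apply: le_trans i1 _; rewrite -mulrA ler_wpM2l // ltW.
  by apply: le_trans d1 _; rewrite mulrAC [leRHS]mulrC ler_wpM2l // ltW.
elim: J => [|J [C [C0 IH]]].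
  have al0 := a0 0%N; have aV0 : 0 < (a 0%N)^-1 by rewrite invr_gt0.
  exists (a 0%N + (a 0%N)^-1); split; first by rewrite addr_gt0.
  move=> x Kx u _ j; rewrite leqn0 => /eqP->.
  have := q0 (u 0%N) (u 1%N); move: (_ + _) => h h0; split.
    rewrite mulrA mulrDl mulVf ?gt_eqF // mulrDl mul1r lerDr.
    by rewrite !mulr_ge0 // ltW.
  by rewrite mulrDl lerDl mulr_ge0 // ltW.
have [D [D0 HD]] := H J.+1.
have al0 := a0 J.+1; have aV0 : 0 < (a J.+1)^-1 by rewrite invr_gt0.
exists (C + D * (a J.+1 + (a J.+1)^-1)); split.
  by rewrite addr_gt0 // mulr_gt0 // addr_gt0.
move=> x Kx u ux j; rewrite leq_eqVlt => /predU1P[->|jJ].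
  have [] := HD x Kx u ux; have := q0 (u 0%N) (u 1%N).
  have := q0 (u J.+1) (u J.+2); move: (_ + _) (_ + _) => h g h0 g0 gh hg.
  have t1 : 1 <= (a J.+1 + (a J.+1)^-1) * a J.+1.
    by rewrite mulrDl mulVf ?gt_eqF // lerDr mulr_ge0 // ltW.
  have t2 : a J.+1 <= a J.+1 + (a J.+1)^-1 by rewrite lerDl ltW.
  split.
    apply: le_trans gh _; rewrite mulrDl -[leLHS]add0r lerD //.
      by rewrite !mulr_ge0 // ltW.
    by rewrite -mulrA ler_wpM2l ?(ltW D0) // mulrA ler_peMl.
  apply: (@le_trans _ _ (a J.+1 * (D * h))); first by rewrite ler_wpM2l // ltW.
  rewrite mulrDl -[leLHS]add0r lerD //; first by rewrite mulr_ge0 // ltW.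
  by rewrite mulrA ler_wpM2r // [leLHS]mulrC ler_wpM2l // (ltW D0).
have [i1 i2] := IH x Kx u ux j jJ.
have r0 : 0 <= D * (a J.+1 + (a J.+1)^-1) by rewrite mulr_ge0 ?addr_ge0 // ltW.
split; rewrite mulrDl.
  by apply: le_trans i1 _; rewrite lerDl mulr_ge0 // mulr_ge0 // ltW.
by apply: le_trans i2 _; rewrite lerDl mulr_ge0.
Qed.
End TransferMatrices.
(** * Two-sided bounds for generalized eigenvectors *)

Theorem theoremA (R : realType) (a b : nat -> R) (N r i : nat) (K : set R)
  (a_gt0 : forall n, 0 < a n) (N_gt0 : (0 < N)%N) (r_gt0 : (0 < r)%N)
  (i_lt_N : (i < N)%N) (K_compact : compact K) (K_sub : K `<=` Lambda a b N i)
  (a_ratio : a (n.+1 * N + i - 1)%N / a (n * N + i - 1)%N @[n --> \oo]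
             --> (1 : R))
  (X_in_D : in_D r K (fun n => N_step_transfer_mx a b N (n * N + i)%N)) :
  exists c : R, 1 < c /\
    forall x, K x -> forall u, gen_eigenvector a b x u ->
    forall n, (1 <= n)%N ->
      c^-1 * (u 0%N ^+ 2 + u 1%N ^+ 2)
        <= a (n * N + i - 1)%N
           * (u (n * N + i - 1)%N ^+ 2 + u (n * N + i)%N ^+ 2)
        <= c * (u 0%N ^+ 2 + u 1%N ^+ 2).
Proof.
have [w [B [S [w0 wB ws wS HO]]]] := in_D_majorant r_gt0 X_in_D.
have [P PP] := choice (fun n => discr_N_step_poly a b N (n * N + i)).
have [|e [n0 [e0 discn]]] :=
    poly_uniformly_negative K_compact (fun n => (PP n).1).
  move=> x /K_sub [l [l0 dl]]; exists l; split=> //.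
  by under eq_fun do rewrite -(PP _).2.
(* Starting at [n0 + 1] makes every discriminant at most [- e] and every index
   positive. *)
pose X n x := N_step_transfer_mx a b N ((n0 + n).+1 * N + i) x.
pose ent k l x n : R := X n x k l.
have Hent k l : Ord K w r 0 (ent k l) by exact: Ord_shiftn w0 wB ws (HO k l).
pose al n := a ((n0 + n).+1 * N + i).-1.
have idx n : ((n0 + n.+1).+1 * N + i)%N = ((n0 + n).+1 * N + i + N)%N by lia.
have idx0 n : (0 < (n0 + n).+1 * N + i)%N by lia.
have disc_le x n : K x ->
    discr_seq (ent 0 0) (ent 0 1) (ent 1 0) (ent 1 1) x n <= - e.
  move=> Kx; rewrite /discr_seq -discrE (PP _).2; apply: discn => //; lia.
have alE x n : K x ->
    al n.+1 * (ent 0 0 x n * ent 1 1 x n - ent 0 1 x n * ent 1 0 x n) = al n.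
  by move=> _; rewrite -det_ord2 /al idx det_N_step.
have [n1 [C2 [C20 tail]]] := perturbed_elliptic_bounds w0 wB ws r_gt0 wS
  (Hent 0 0) (Hent 0 1) (Hent 1 0) (Hent 1 1) e0 disc_le (fun n => a_gt0 _) alE.
pose J := ((n0 + n1).+1 * N + i).-1.
have [C1 [C10 init]] := eigenvector_initial_bounds b J a_gt0 K_compact.
pose c := 1 + C1 + C1 * C2.
have C12 : 0 < C1 * C2 by rewrite mulr_gt0.
have c1 : 1 < c by rewrite /c; lra.
have c0 : 0 < c by lra.
exists c; split=> // x Kx u ux n n1'.
set j := (n * N + i - 1)%N; have jE : (n * N + i)%N = j.+1 by rewrite /j; lia.
rewrite jE; set h := u 0%N ^+ 2 + _; set g := a j * _.
have h0 : 0 <= h by rewrite addr_ge0 ?sqr_ge0.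
have g0 : 0 <= g by rewrite mulr_ge0 ?addr_ge0 ?sqr_ge0 // ltW.
suff [hg gh] : h <= (C1 + C1 * C2) * g /\ g <= (C1 + C1 * C2) * h.
  apply/andP; split; last by rewrite /c; lra.
  by rewrite mulrC ler_pdivrMr // mulrC /c; lra.
(* [J] is where the almost constant energy takes over from the one-step
   bounds. *)
have [jJ|Jj] := leqP j J.
  have [i1 i2] := init x Kx u ux j jJ.
  by split; rewrite mulrDl; [apply: le_trans i1 _|apply: le_trans i2 _];
    rewrite lerDl mulr_ge0 // ltW.
have [i1 i2] := init x Kx u ux J (leqnn J).
pose v1 n := u ((n0 + n).+1 * N + i).-1.
pose v2 n := u ((n0 + n).+1 * N + i)%N.
have nn : n = (n0 + (n1 + (n - (n0 + n1).+1))).+1.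
  rewrite addnA -addSn subnKC // leqNgt; apply/negP => nlt.
  move: Jj; rewrite ltnNge => /negP; apply.
  have : (n * N <= (n0 + n1).+1 * N)%N by rewrite leq_mul2r ltnW ?orbT.
  by rewrite /j /J -subn1 => nN; rewrite leq_sub2r // leq_add2r.
have st m := N_step_eigenvector N a_gt0 (idx0 m) ux.
have [||t1 t2] := tail x Kx v1 v2 _ _ (n - (n0 + n1).+1)%N.
- by move=> m; rewrite /v1 idx (st m).1.
- by move=> m; rewrite /v2 idx (st m).2.
have jE' : ((n0 + (n1 + (n - (n0 + n1).+1))).+1 * N + i).-1 = j.
  by rewrite -nn /j subn1.
have JE : ((n0 + n1).+1 * N + i)%N = J.+1 by rewrite /J prednK.
rewrite /al /v1 /v2 jE' -nn jE JE in t1 t2.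
split; rewrite mulrDl.
- apply: le_trans i1 _; apply: (@le_trans _ _ (C1 * (C2 * g))).
    by rewrite ler_wpM2l // ltW.
  by rewrite mulrA lerDr mulr_ge0 // ltW.
- apply: le_trans t2 _; apply: (@le_trans _ _ (C2 * (C1 * h))).
    by rewrite ler_wpM2l // ltW.
  by rewrite mulrA (mulrC C2) lerDr mulr_ge0 // ltW.
Qed.
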